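(* Let $n,m\in\mathbb N$ and let $f:\mathbb R\to\mathbb T\mathbb P^m$ be an $n$-th tropical holomorphic curve with a reduced representation $\mathbf f=(f_0,\dots,f_m)$. Suppose there exists $l\in\{0,\dots,m\}$ such that $f_i\oslash f_l$ is well defined for all $i=0,\dots,m$, that $$\limsup_{r\to+\infty}\frac{\log\log T_f(r)}{\log r}=:\rho_2<1,$$ and let $\sigma\in(0,1-\rho_2)$. Then $$\begin{aligned} &\left|\sum_{i=0}^m\sum_{j=1}^nN^{(j)}\left(r,1_0\oslash f_i\right)-\sum_{j=1}^nN^{(j)}\left(r,1_0\oslash C_0(f_0,\dots,f_m)\right)\right|\\ &\le\sum_{j=1}^n\left|N^{(j)}(r,C_0(f_0,\dots,f_m))-\sum_{i=0}^mN^{(j)}\big(r,\overline f_i^{[i]}\big)\right|\\ &\quad+\sum_{i=0}^m\sum_{j=1}^{\lfloor n/2\rfloor}\left|N_{[-2i,0]}^{(2j)}\big(r,1_0\oslash\overline f_i^{[i]}\big)-N_{[-i,i]}^{(2j)}\left(r,1_0\oslash f_i\right)\right|+o\left(\frac{T_f(r)}{r^{\sigma}}\right), \end{aligned}$$ where $r$ approaches infinity outside of a set of finite logarithmic measure.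
   Context: $\mathbb N=\{1,2,\dots\}$. Tropical operations: $a\oplus b=\max\{a,b\}$, $a\otimes b=a+b$, $a\oslash b=a-b$, $1_0=0$; thus $1_0\oslash g=-g$. For $n\in\mathbb N$, an $n$-th tropical meromorphic function is a continuous function $g:\mathbb R\to\mathbb R$ for which there is an increasing sequence of breakpoints without finite accumulation point such that $g$ is a polynomial on each segment, the supremum of the degrees being $n$; a $0$-th one is a constant. Sign convention: $\operatorname{sgn}(x^{\pm})=\operatorname{sgn}(x)$ for $x\ne0$ and $\operatorname{sgn}(0^{\pm})=\pm1$. $\omega_g^{(j)}(x)=\frac1{j!}\left(\operatorname{sgn}^{j+1}(x^+)g^{(j)}(x^+)-\operatorname{sgn}^{j+1}(x^-)g^{(j)}(x^-)\right)$, with one-sided derivatives. $x$ is a $j$-th root (pole) of $g$ if $\omega_g^{(j)}(x)>0$ ($<0$), with multiplicity $|\omega_g^{(j)}(x)|$. $g$ is tropical entire if it has no $j$-th poles for any $j$. $N^{(j)}(r,g)=\frac12\sum_z|\omega_g^{(j)}(z)|(r-|z|)^j$, over all $j$-th poles $z$ of $g$ in $(-r,r)$; for $-r\le r_1\le r_2\le r$, $N_{[r_1,r_2]}^{(j)}(r,g)$ is the same sum restricted to the $j$-th poles $z\in[r_1,r_2]$. A polynomial $p$ of degree $k\ge1$ is called well defined if $p(x)-p(0)=\sum_{s=1}^M a_{2s-1}x^{2s-1}$ when $k=2M-1$, and $p(x)-p(0)=\sum_{s=1}^M a_{2s}x^{2s}$ when $k=2M$, where the coefficients are either all non-negative or all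 non-positive; constants also count as well defined. A continuous piecewise polynomial function is well defined if it is a well defined polynomial on each of its segments. $\mathbb T\mathbb P^m$ is the quotient of $(\mathbb R\cup\{-\infty\})^{m+1}\setminus\{(-\infty,\dots,-\infty)\}$ by $(a_0,\dots,a_m)\sim(a_0+\lambda,\dots,a_m+\lambda)$, $\lambda\in\mathbb R$. An $n$-th tropical holomorphic curve is a map $f=[f_0:\cdots:f_m]:\mathbb R\to\mathbb T\mathbb P^m$ where $f_i$ is an $n_i$-th tropical entire function, $n_i\in\mathbb N\cup\{0\}$, $\max_in_i=n$. The tuple $(f_0,\dots,f_m)$ is a reduced representation if, for every $j$, no point is a $j$-th root common to all of $f_0,\dots,f_m$. $T_f(r)=\frac12(F(r)+F(-r))-F(0)$ with $F=\max_{0\le i\le m}f_i$ (for a reduced representation). Shifts: $\overline g(x)=g(x+1)$, $\overline g^{[k]}(x)=g(x+k)$. The tropical Casoratian is $C_0(f_0,\dots,f_m)(x)=\max_\pi\sum_{i=0}^m\overline f_i^{[\pi(i)]}(x)$, the maximum over all permutations $\pi$ of $\{0,\dots,m\}$. A set $E\subset(0,\infty)$ has finite logarithmic measure if $\int_{E\cap[1,\infty)}dr/r<\infty$. *)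

(* Defs.v *)
From HB Require Import structures.
From mathcomp Require Import all_boot all_order all_algebra.
From mathcomp Require Import perm.
From mathcomp Require Import all_classical all_reals all_analysis.
Set Implicit Arguments.
Unset Strict Implicit.
Unset Printing Implicit Defensive.
Import Order.TTheory GRing.Theory Num.Theory.
Import numFieldNormedType.Exports.
Local Open Scope classical_set_scope.
Local Open Scope ring_scope.

(* The increasing sequence of breakpoints (finite, infinite on one side or on
   both) without finite accumulation point is encoded by its range [B].  A
   segment is exhausted by its compact subintervals [[a, b]], on all of which
   the polynomial [p] is necessarily the same. *)
Definition piecewise_poly (R : realType) (P : {poly R} -> Prop) (g : R -> R) :=
  continuous g /\
  exists B : set R,
    (forall a b : R, finite_set (B `&` `[a, b])) /\
    (forall a b : R, a < b -> (forall z, a < z < b -> ~ B z) ->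
      exists2 p : {poly R}, P p & forall x, a <= x <= b -> g x = p.[x]).

(* Recall that [size p] is the degree of [p] plus one. *)
Definition trop_meromorphic (R : realType) (n : nat) (g : R -> R) :=
  if n is 0%N then exists c : R, forall x, g x = c
  else
    piecewise_poly (fun p => (size p <= n.+1)%N) g /\
    exists (a b : R) (p : {poly R}),
      [/\ a < b, size p = n.+1 & forall x, a <= x <= b -> g x = p.[x]].

Definition sgn_right (R : realType) (x : R) : R :=
  if x == 0 then 1 else Num.sg x.

Definition sgn_left (R : realType) (x : R) : R :=
  if x == 0 then -1 else Num.sg x.

Definition right_derive (R : realType) (g : R -> R) (x : R) : R :=
  lim (h^-1 * (g (x + h) - g x) @[h --> 0^'+]).

Definition left_derive (R : realType) (g : R -> R) (x : R) : R :=
  lim (h^-1 * (g (x + h) - g x) @[h --> 0^'-]).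

Definition omega (R : realType) (j : nat) (g : R -> R) (x : R) : R :=
  (j`!%:R)^-1 *
  (sgn_right x ^+ j.+1 * iter j (@right_derive R) g x -
   sgn_left x ^+ j.+1 * iter j (@left_derive R) g x).

Definition trop_root (R : realType) (j : nat) (g : R -> R) (x : R) : Prop :=
  0 < omega j g x.

Definition trop_pole (R : realType) (j : nat) (g : R -> R) (x : R) : Prop :=
  omega j g x < 0.

Definition trop_mult (R : realType) (j : nat) (g : R -> R) (x : R) : R :=
  `|omega j g x|.

Definition trop_entire (R : realType) (n : nat) (g : R -> R) :=
  trop_meromorphic n g /\
  forall (j : nat) (x : R), (1 <= j)%N -> ~ trop_pole j g x.

(* For tropical meromorphic [g] the index sets of these sums are finite. *)
Definition Ncount (R : realType) (j : nat) (r : R) (g : R -> R) : R :=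
  2^-1 * \sum_(z \in [set z | - r < z < r /\ trop_pole j g z])
           (trop_mult j g z * (r - `|z|) ^+ j).

Definition Ncount_on (R : realType) (j : nat) (r1 r2 r : R) (g : R -> R) : R :=
  2^-1 * \sum_(z \in [set z | [/\ - r < z < r, r1 <= z <= r2
                                & trop_pole j g z]])
           (trop_mult j g z * (r - `|z|) ^+ j).

Definition trop_one (R : realType) : R -> R := fun=> 0.

Definition trop_div (R : realType) (g h : R -> R) : R -> R :=
  fun x => g x - h x.

Definition well_defined_poly (R : realType) (p : {poly R}) :=
  (size p <= 1)%N \/
  exists (M : nat) (a : nat -> R),
    [/\ (1 <= M)%N,
        (size p = (2 * M - 1).+1%N /\
         forall x, p.[x] - p.[0]
                   = \sum_(1 <= s < M.+1) a (2 * s - 1)%N * x ^+ (2 * s - 1)%N)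
        \/
        (size p = (2 * M).+1%N /\
         forall x, p.[x] - p.[0]
                   = \sum_(1 <= s < M.+1) a (2 * s)%N * x ^+ (2 * s)%N)
      & (forall k, 0 <= a k) \/ (forall k, a k <= 0)].

Definition well_defined (R : realType) (g : R -> R) :=
  piecewise_poly (@well_defined_poly R) g.

Definition homogeneous_coord (R : realType) (m : nat)
    (a : 'I_m.+1 -> \bar R) : Prop :=
  (forall i, a i <> +oo%E) /\ (exists i, a i <> -oo%E).

Definition trop_class (R : realType) (m : nat) (a : 'I_m.+1 -> \bar R) :
    set ('I_m.+1 -> \bar R) :=
  [set b | exists lam : R, forall i, b i = (a i + lam%:E)%E].

(* Tropical projective space: a point is an equivalence class. *)
Record trop_proj (R : realType) (m : nat) := TropProj {
  trop_proj_set : set ('I_m.+1 -> \bar R);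
  trop_proj_setP : exists2 a : 'I_m.+1 -> \bar R,
    homogeneous_coord a & trop_proj_set = trop_class a }.

(* [f] is an [n]-th tropical holomorphic curve, as witnessed by
   [f = [ff 0 : ... : ff m]]. *)
Definition holomorphic_curve_rep (R : realType) (n m : nat)
    (f : R -> trop_proj R m) (ff : 'I_m.+1 -> R -> R) : Prop :=
  (exists d : 'I_m.+1 -> nat,
     (forall i, trop_entire (d i) (ff i)) /\ \max_i d i = n) /\
  (forall x, trop_proj_set (f x) = trop_class (fun i => (ff i x)%:E)).

Definition reduced (R : realType) (m : nat) (ff : 'I_m.+1 -> R -> R) : Prop :=
  forall (j : nat) (x : R), (1 <= j)%N -> ~ (forall i, trop_root j (ff i) x).

Definition reduced_representation (R : realType) (n m : nat)
    (f : R -> trop_proj R m) (ff : 'I_m.+1 -> R -> R) : Prop :=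
  holomorphic_curve_rep n f ff /\ reduced ff.

Definition trop_max (R : realType) (m : nat) (ff : 'I_m.+1 -> R -> R)
    (x : R) : R :=
  \big[Num.max/ff ord0 x]_(i < m.+1) ff i x.

(* The characteristic function of the curve having the reduced
   representation [ff]. *)
Definition Tchar (R : realType) (m : nat) (ff : 'I_m.+1 -> R -> R) (r : R) : R :=
  2^-1 * (trop_max ff r + trop_max ff (- r)) - trop_max ff 0.

Definition trop_shift (R : realType) (k : nat) (g : R -> R) : R -> R :=
  fun x => g (x + k%:R).

(* The default element of the maximum is the term of the identity. *)
Definition casoratian (R : realType) (m : nat) (ff : 'I_m.+1 -> R -> R)
    (x : R) : R :=
  \big[Num.max / (\sum_(i < m.+1) trop_shift i (ff i) x)]_(s : 'S_m.+1)
     \sum_(i < m.+1) trop_shift (s i) (ff i) x.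

(* [ln] is total, with value [0] on nonpositive reals. *)
Definition hyper_order (R : realType) (T : R -> R) : \bar R :=
  limf_esup (fun r : R => (ln (ln (T r)) / ln r)%:E) +oo%R.

Definition finite_log_measure (R : realType) (E : set R) : Prop :=
  [/\ measurable E, E `<=` `]0, +oo[ &
      (\int[lebesgue_measure]_(r in E `&` `[1%R, +oo[) (r^-1)%:E < +oo)%E].

(* Main.v *)
(** Every root z of a tropical entire function f of degree at most n
    contributes, for the orders j = 1, ..., n, the nonnegative convex kernel
    omega_j(z) (r - |z|)^j.  Telescoping the jumps of the polynomial germs of f
    shows that f(r) and f(-r) are the germs of f at 0 plus the kernels of the
    positive, resp. negative, roots; adding the two gives the Jensen formula
    f(r) + f(-r) - 2 f(0) = sum of all kernels.  With the Jensen formula for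
    f_i, for its shift and for the Casoratian, the difference of the two sides
    of the theorem reduces to
    - the change of the kernels under a shift by i <= m, which outside the
      window [-i, i] (and everywhere for odd j) is at most
      S(r + m) - S(r - m), where S is the sum of the kernels of all the f_i;
    - the defect C_0(f) - sum_i f_i(. + i), a maximum of increments of
      f_i - f_0, evaluated at r, -r and 0.  These increments are those of a
      fixed polynomial P plus increments of kernels, and the former are
      O(P(r) / r).
    Since S and all the |P| are O(T_f + 1), everything is small once
    S(r + m) - S(r - m) = o(S(r) / r^sigma) off a set of finite logarithmic
    measure, which is a Borel-type growth lemma for log S.  The only other
    possibility is that T_f is not eventually bounded below by a multiple of r,
    and then all the errors vanish identically. *)
Require Import Defs.
From HB Require Import structures.
From mathcomp Require Import all_boot all_order all_algebra perm.
From mathcomp Require Import all_classical all_reals all_analysis.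
From mathcomp Require Import measurable_realfun.
From mathcomp Require Import ring lra.
Set Implicit Arguments.
Unset Strict Implicit.
Unset Printing Implicit Defensive.
Import Order.TTheory GRing.Theory Num.Theory.
Import numFieldNormedType.Exports.
Local Open Scope classical_set_scope.
Local Open Scope ring_scope.
(** * Polynomial germs *)

(** The interval contains [x]: a germ also fixes the value [g x], so the two germs at [x] agree
    there, which encodes continuity. *)
Definition right_germ {R : realType} (g : R -> R) (x : R) : set {poly R} :=
  [set p | exists2 e, 0 < e & forall y, x <= y <= x + e -> g y = p.[y]].

Definition left_germ {R : realType} (g : R -> R) (x : R) : set {poly R} :=
  [set p | exists2 e, 0 < e & forall y, x - e <= y <= x -> g y = p.[y]].

(** A local substitute for [piecewise_poly]: no set of breakpoints has to be followed through sums,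
    maxima and shifts. That the jumps on a bounded interval are finite in number is recovered in
    [germ_telescope]. *)
Definition locally_poly {R : realType} (n : nat) (g : R -> R) : Prop :=
  forall x, (exists2 p, right_germ g x p & (size p <= n.+1)%N) /\
            (exists2 p, left_germ g x p & (size p <= n.+1)%N).

Definition rgerm {R : realType} (g : R -> R) (x : R) : {poly R} :=
  xget 0 (right_germ g x).

Definition lgerm {R : realType} (g : R -> R) (x : R) : {poly R} :=
  xget 0 (left_germ g x).

Section Germs.
Context {R : realType}.
Implicit Types (g h : R -> R) (p q : {poly R}) (x y a b : R).

(** Otherwise [p - q] would vanish at [size (p - q)] distinct points [a + (b - a) / (i + 1)], more
    than its degree allows. *)
Lemma poly_eq_itv p q a b : a < b ->
  (forall y, a <= y <= b -> p.[y] = q.[y]) -> p = q.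
Proof.
move=> ab pq; apply/eqP; rewrite -subr_eq0; apply/negP => /negP pq0.
pose f i : R := a + (b - a) / i.+1%:R.
pose s := map f (iota 0 (size (p - q))).
suff: (size s < size (p - q)%R)%N by rewrite size_map size_iota ltnn.
apply: max_poly_roots => //; last first.
  rewrite map_inj_in_uniq ?iota_uniq // => i j _ _ /addrI.
  move/(mulfI _); rewrite subr_eq0 gt_eqF// => /(_ isT)/invr_inj/eqP.
  by rewrite eqr_nat eqSS => /eqP.
apply/allP => y /mapP[i _ ->]; rewrite rootE !hornerE pq ?subrr//.
have ba0 : 0 <= b - a by rewrite subr_ge0 ltW.
by rewrite /f lerDl divr_ge0//= -lerBrDl ler_pdivrMr// ler_peMr// ler1n.
Qed.

Lemma right_germ_inj g x p q : right_germ g x p -> right_germ g x q -> p = q.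
Proof.
move=> [e e0 gp] [d d0 gq]; have m0 : 0 < Num.min e d by rewrite lt_min e0.
apply: (@poly_eq_itv p q x (x + Num.min e d)); rewrite ?ltrDl// => y /andP[xy].
rewrite -lerBlDl le_min !lerBlDl => /andP[ye yd].
by rewrite -gp ?xy// -gq ?xy.
Qed.

Lemma left_germ_inj g x p q : left_germ g x p -> left_germ g x q -> p = q.
Proof.
move=> [e e0 gp] [d d0 gq]; have m0 : 0 < Num.min e d by rewrite lt_min e0.
apply: (@poly_eq_itv p q (x - Num.min e d) x); rewrite ?gtrBl// => y /andP[].
rewrite lerBlDr -lerBlDl le_min !lerBlDl -!lerBlDr => /andP[ye yd xy].
by rewrite -gp ?xy ?andbT// -gq ?xy ?andbT.
Qed.

Lemma rgermE g x p : right_germ g x p -> rgerm g x = p.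
Proof. by move=> gp; exact: (right_germ_inj (xgetI 0 gp)). Qed.

Lemma lgermE g x p : left_germ g x p -> lgerm g x = p.
Proof. by move=> gp; exact: (left_germ_inj (xgetI 0 gp)). Qed.

Lemma rgermP n g x : locally_poly n g ->
  right_germ g x (rgerm g x) /\ (size (rgerm g x) <= n.+1)%N.
Proof. by move=> /(_ x)[[p gp sp] _]; rewrite (rgermE gp). Qed.

Lemma lgermP n g x : locally_poly n g ->
  left_germ g x (lgerm g x) /\ (size (lgerm g x) <= n.+1)%N.
Proof. by move=> /(_ x)[_ [p gp sp]]; rewrite (lgermE gp). Qed.

Lemma horner_rgerm n g x : locally_poly n g -> (rgerm g x).[x] = g x.
Proof. by move=> /(rgermP x)[[e e0 ->]]//; rewrite lexx lerDl ltW. Qed.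

Lemma horner_lgerm n g x : locally_poly n g -> (lgerm g x).[x] = g x.
Proof. by move=> /(lgermP x)[[e e0 ->]]//; rewrite lexx gerBl ltW. Qed.

Lemma horner_cvg_dnbhs p x :
  h^-1 * (p.[x + h] - p.[x]) @[h --> 0^'] --> p^`().[x].
Proof.
have [dp <-] := is_derive_poly p x.
apply: cvg_trans dp; apply: near_eq_cvg; near=> h.
by rewrite /= /GRing.scale/= mulr1 [x + h]addrC.
Unshelve. all: by end_near.
Qed.

Lemma right_derive_poly g x e p : 0 < e ->
  (forall y, x <= y < x + e -> g y = p.[y]) -> right_derive g x = p^`().[x].
Proof.
move=> e0 gp; apply: cvg_lim; first exact: norm_hausdorff.
have cvp := cvg_dnbhs_at_right (@horner_cvg_dnbhs p x).
apply: cvg_trans cvp.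
apply: near_eq_cvg; near=> h.
have h0 : 0 < h by near: h; exact: nbhs_right_gt.
have he : h < e by near: h; exact: nbhs_right_lt.
by rewrite !gp// ?lexx ?ltrDl ?ltrD2l ?he ?lerDl ?ltW.
Unshelve. all: by end_near. Qed.

Lemma left_derive_poly g x e p : 0 < e ->
  (forall y, x - e < y <= x -> g y = p.[y]) -> left_derive g x = p^`().[x].
Proof.
move=> e0 gp; apply: cvg_lim; first exact: norm_hausdorff.
have cvp := cvg_dnbhs_at_left (@horner_cvg_dnbhs p x).
apply: cvg_trans cvp.
apply: near_eq_cvg; near=> h.
have h0 : h < 0 by near: h; exact: nbhs_left_lt.
have he : - e < h by near: h; apply: nbhs_left_gt; rewrite oppr_lt0.
by rewrite !gp// ?lexx ?gtrBl ?e0// ltrD2l he gerDl ltW.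
Unshelve. all: by end_near. Qed.

Lemma iter_right_derive g x p j : right_germ g x p ->
  iter j (@right_derive R) g x = p^`(j).[x].
Proof.
(* The next derivative at [y] uses values to the right of [y], so the induction runs over all of
   [[x, x + e[], where every point has room to its right. *)
move=> [e e0 gp]; suff: forall y, x <= y < x + e ->
  iter j (@right_derive R) g y = p^`(j).[y] by apply; rewrite lexx ltrDl.
elim: j => [|j IHj] y /andP[xy ye].
  by rewrite /= gp// xy ltW.
rewrite iterS derivnS; apply: (@right_derive_poly _ _ (x + e - y)).
  by rewrite subr_gt0.
move=> z /andP[yz zy]; apply: IHj; rewrite (le_trans xy yz)/=.
by move: zy; rewrite addrC subrK.
Qed.

Lemma iter_left_derive g x p j : left_germ g x p ->
  iter j (@left_derive R) g x = p^`(j).[x].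
Proof.
move=> [e e0 gp]; suff: forall y, x - e < y <= x ->
  iter j (@left_derive R) g y = p^`(j).[y] by apply; rewrite lexx gtrBl e0.
elim: j => [|j IHj] y /andP[ey yx].
  by rewrite /= gp// yx ltW.
rewrite iterS derivnS; apply: (@left_derive_poly _ _ (y - (x - e))).
  by rewrite subr_gt0.
move=> z /andP[yz zy]; apply: IHj; rewrite (le_trans zy yx) andbT.
by move: yz; rewrite subKr.
Qed.

(** The factor 1/j! turns the derivatives into Taylor coefficients at [x]; up to signs, [omega] is
    the jump of the j-th coefficient between the two germs. *)
Lemma omegaE n g x j : locally_poly n g ->
  omega j g x = sgn_right x ^+ j.+1 * (rgerm g x)^`N(j).[x] -
                sgn_left x ^+ j.+1 * (lgerm g x)^`N(j).[x].
Proof.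
move=> gn; have [rg _] := rgermP x gn; have [lg _] := lgermP x gn.
rewrite /omega (iter_right_derive _ rg) (iter_left_derive _ lg).
have j0 : j`!%:R != 0 :> R by rewrite pnatr_eq0 -lt0n fact_gt0.
rewrite !nderivn_def !hornerMn -[_ *+ _ as X in _ * X - _]mulr_natl.
by rewrite -[X in _ - _ * X]mulr_natl !(mulrCA _ _%:R) -mulrBr mulKf.
Qed.

End Germs.
(** * Telescoping the jumps of the germs *)

Section Telescope.
Context {R : realType}.
Implicit Types (g : R -> R) (p q : {poly R}) (x y z a b r h : R) (s : seq R).

(** Real induction: the supremum of the t in ]a, b] with [Q a t] is attained, and by the local
    hypothesis it cannot lie before b. *)
Lemma cousin (Q : R -> R -> Prop) :
  (forall a b c, a < b -> b < c -> Q a b -> Q b c -> Q a c) ->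
  (forall x, exists2 e, 0 < e &
     forall a b, x - e < a -> a <= x -> x <= b -> b < x + e -> a < b -> Q a b) ->
  forall a b, a < b -> Q a b.
Proof.
move=> Qtrans Qloc a b ab.
pose A := [set t | a < t <= b /\ Q a t].
have [ea ea0 Qa] := Qloc a.
have [u [au ub Qau]] : exists u, [/\ a < u, u <= b & Q a u].
  exists (Num.min b (a + ea / 2)).
  have aea : a < a + ea / 2 by rewrite ltrDl divr_gt0.
  have am : a < Num.min b (a + ea / 2) by rewrite lt_min ab.
  split => //; first by rewrite ge_min lexx.
  apply: Qa => //; rewrite ?gtrBl// ?ltW// gt_min ltrD2l ltr_pdivrMr//.
  by rewrite ltr_pMr ?ltr1n ?orbT.
have Au : A u by split; rewrite ?au.
have Asup : has_sup A by split; [exists u|exists b => t [/andP[]]].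
set t := sup A; have [e e0 Qt] := Qloc t.
have tA : forall v, A v -> v <= t := sup_upper_bound Asup.
have ut : u <= t by exact: tA.
have tb : t <= b by apply: ge_sup => [|v [/andP[]]]; first by exists u.
have [v [/andP[av vb] Qav] tv] := sup_adherent e0 Asup.
have vt : v <= t by apply: tA; split; rewrite ?av.
(* [w] exceeds the supremum [t] unless [t = b]. A point [v] of [A] close to [t], joined to [w] by
   the local hypothesis at [t], gives [Q a w]. *)
pose w := Num.min b (t + e / 2).
have tte : t < t + e / 2 by rewrite ltrDl divr_gt0.
have tw : t <= w by rewrite le_min tb ltW.
have wb : w <= b by rewrite ge_min lexx.
have Qaw : Q a w.
  have [vw|] := ltP v w; last first.
    by move=> wv; rewrite (_ : w = v)//; apply/eqP; rewrite eq_le wv (le_trans vt).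
  apply: (Qtrans _ _ _ av vw Qav); apply: Qt => //.
  rewrite gt_min ltrD2l ltr_pdivrMr//.
  by rewrite ltr_pMr ?ltr1n ?orbT.
have wt : w <= t.
  apply: tA; split => //.
  by rewrite wb (lt_le_trans av (le_trans vt tw)).
suff <- : w = b by [].
apply/eqP; rewrite eq_le wb /= leNgt; apply/negP => wltb.
have : w = t + e / 2.
  by move: wltb; rewrite /w minEle; case: ifP => // _; rewrite ltxx.
by move=> wE; move: wt; rewrite wE leNgt tte.
Qed.

Lemma rgerm_itv g p a b x : (forall y, a <= y <= b -> g y = p.[y]) ->
  a <= x < b -> rgerm g x = p.
Proof.
move=> gp /andP[ax xb]; apply: rgermE; exists (b - x); first by rewrite subr_gt0.
by move=> y; rewrite addrC subrK => /andP[xy yb]; rewrite gp// yb (le_trans ax).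
Qed.

Lemma lgerm_itv g p a b x : (forall y, a <= y <= b -> g y = p.[y]) ->
  a < x <= b -> lgerm g x = p.
Proof.
move=> gp /andP[ax xb]; apply: lgermE; exists (x - a); first by rewrite subr_gt0.
by move=> y; rewrite subKr => /andP[ay yx]; rewrite gp// ay (le_trans yx).
Qed.

(** Near each x the only possible jump is at x itself, and lists of jumps on adjacent intervals can
    be concatenated; [cousin] then yields one finite list for the whole interval. *)
Lemma germ_telescope n g a b : locally_poly n g -> a < b ->
  exists s, [/\ uniq s, forall z, z \in s -> a < z < b,
    forall z, a < z < b -> z \notin s -> rgerm g z = lgerm g z &
    lgerm g b = rgerm g a + \sum_(z <- s) (rgerm g z - lgerm g z)].
Proof.
move=> gn; move: a b; apply: cousin => [a b c ab bc|x].
  move=> [s [us sab gs lb]] [t [ut tbc gt lc]].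
  (* The common endpoint becomes interior; its own term links [lgerm g b] to [rgerm g b]. *)
  exists (s ++ b :: t); split.
  - have bt : b \notin t by apply/negP => /tbc; rewrite ltxx.
    rewrite cat_uniq us [uniq (_ :: _)]/= ut bt !andbT; apply/hasPn => z.
    rewrite inE => /predU1P[->|zt]; apply/negP => /sab/andP[_].
      by rewrite ltxx.
    by have /andP[bz _] := tbc _ zt; move=> /(lt_trans bz); rewrite ltxx.
  - move=> z; rewrite mem_cat inE => /or3P[/sab/andP[az zb]|/eqP->|/tbc/andP[bz zc]].
    + by rewrite az (lt_trans zb).
    + by rewrite ab.
    + by rewrite zc (lt_trans ab).
  - move=> z /andP[az zc]; rewrite mem_cat inE !negb_or => /and3P[zs zb zt].
    have [zltb|bltz|zeqb] := ltgtP z b.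
    + by rewrite gs ?az.
    + by rewrite gt ?bltz.
    + by rewrite zeqb eqxx in zb.
  - by rewrite big_cat big_cons lc /= lb; ring.
have [[dr dr0 gr] _] := rgermP x gn; have [[dl dl0 gl] _] := lgermP x gn.
exists (Num.min dr dl); first by rewrite lt_min dr0.
move=> a b xa ax xb bx ab.
have {xa} xa : x - dl <= a.
  by rewrite (le_trans _ (ltW xa))// lerD2l lerN2 ge_min lexx orbT.
have {bx} bx : b <= x + dr.
  by rewrite (le_trans (ltW bx))// lerD2l ge_min lexx.
have Rl z : a <= z < x -> rgerm g z = lgerm g x.
  by move=> /andP[az zx]; apply: rgerm_itv gl _; rewrite zx andbT (le_trans xa).
have Ll z : a < z < x -> lgerm g z = lgerm g x.
  move=> /andP[az zx]; apply: lgerm_itv gl _.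
  by rewrite (ltW zx) andbT (le_lt_trans xa).
have Lr z : x < z <= b -> lgerm g z = rgerm g x.
  by move=> /andP[xz zb]; apply: lgerm_itv gr _; rewrite xz (le_trans zb).
have Rr z : x < z < b -> rgerm g z = rgerm g x.
  move=> /andP[xz zb]; apply: rgerm_itv gr _.
  by rewrite (ltW xz) (lt_le_trans zb).
have jmp z : a < z < b -> z != x -> rgerm g z = lgerm g z.
  move=> /andP[az zb]; rewrite neq_lt => /orP[zx|xz].
    by rewrite Rl ?Ll// ?az// ltW.
  by rewrite Rr ?Lr// ?xz// ltW.
(* The point [x] is listed only if it is interior to ]a, b[; if it is an endpoint, the list is
   empty. *)
move: ax; rewrite le_eqVlt => /predU1P[ax|ax].
  exists [::]; split=> //; last by rewrite big_nil addr0 Lr -?ax ?ab ?lexx.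
  by move=> z azb _; apply: jmp => //; rewrite -ax; case/andP: azb => /gt_eqF->.
move: xb; rewrite le_eqVlt => /predU1P[xb|xb].
  exists [::]; split=> //; last by rewrite big_nil addr0 Rl -?xb// ?ax ?lexx.
  by move=> z azb _; apply: jmp => //; rewrite xb; case/andP: azb => _ /lt_eqF->.
exists [:: x]; split=> //.
- by move=> z; rewrite inE => /eqP->; rewrite ax.
- by move=> z azb; rewrite inE; exact: jmp.
- by rewrite big_seq1 Rl ?lexx// Lr ?xb ?lexx// addrCA subrr addr0.
Qed.

End Telescope.

(** * Sums over roots and the Jensen formula *)

Section RootSum.
Context {R : realType}.
Implicit Types (g : R -> R) (p q : {poly R}) (x y z a b r h : R) (s : seq R).
Implicit Types (P : set R).

(* Truncating at 0 makes sums over all roots equal to sums over ]-r, r[. *)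
Definition kern (j : nat) r z : R := Num.max (r - `|z|) 0 ^+ j.

Lemma kern0 j r z : (0 < j)%N -> r <= `|z| -> kern j r z = 0.
Proof.
by move=> j0 rz; rewrite /kern max_r ?subr_le0// expr0n gtn_eqF.
Qed.

Lemma kernE j r z : `|z| <= r -> kern j r z = (r - `|z|) ^+ j.
Proof. by move=> zr; rewrite /kern max_l ?subr_ge0. Qed.

Lemma kern_ge0 j r z : 0 <= kern j r z.
Proof. by rewrite exprn_ge0// le_max lexx orbT. Qed.

Lemma le_kern j x y z w : x - `|z| <= y - `|w| -> kern j x z <= kern j y w.
Proof.
move=> xy; have m0 (t : R) : 0 <= Num.max t 0 by rewrite le_max lexx orbT.
by apply: lerXn2r; rewrite ?nnegrE// ge_max m0 le_max xy.
Qed.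

(** The quotient of the kernel by its radius is nondecreasing, as for any convex function vanishing
    at 0: one factor of the power has this property and the others are monotone. Multiplying out
    includes [x = 0]. *)
Lemma kern_star j x y z : (0 < j)%N -> 0 <= x <= y ->
  kern j x z * y <= kern j y z * x.
Proof.
case: j => // j _ /andP[x0 xy]; rewrite /kern !exprS.
set u := Num.max (x - _) 0; set v := Num.max (y - _) 0.
have u0 : 0 <= u by rewrite /u le_max lexx orbT.
have uv : u <= v by rewrite /u /v ge_max !le_max lexx !orbT lerD2r xy.
have uvx : u * y <= v * x.
  rewrite /u; case: (leP (x - `|z|) 0) => xz.
    by rewrite mul0r mulr_ge0// (le_trans u0).
  have -> : v = y - `|z| by rewrite /v max_l// (le_trans (ltW xz))// lerD2r.
  have z0 := normr_ge0 z; nra.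
rewrite mulrAC [leRHS]mulrAC; apply: ler_pM => //.
- by rewrite mulr_ge0// (le_trans x0).
- by rewrite exprn_ge0.
- by rewrite lerXn2r ?nnegrE// (le_trans u0).
Qed.

Lemma fsum_seq P (F : R -> R) s : uniq s -> (forall z, z \notin s -> F z = 0) ->
  \sum_(z \in P) F z = \sum_(z <- s | z \in P) F z.
Proof.
move=> us F0; rewrite fsbig_mkcond [RHS]big_mkcond (fsbig_seq _ _ us).
apply/esym/fsbig_widen => // z [_ /= /negP zs].
by rewrite /patch; case: ifP => // _; exact: F0.
Qed.

Lemma in_set_pred (Q : pred R) z : (z \in [set t | Q t]) = Q z.
Proof. by apply/idP/idP => [/set_mem|/mem_set]. Qed.

(** [omega] keeps its sign, so that the representation formulas also cover functions with poles,
    such as the Casoratian. *)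
Definition root_sum n g P r : R :=
  \sum_(1 <= j < n.+1) \sum_(z \in P) omega j g z * kern j r z.

Lemma omega_support n g r : locally_poly n g -> exists2 s, uniq s &
  forall z j, z \notin s -> omega j g z = 0 \/ r <= `|z|.
Proof.
move=> gn; have [r0|r0] := lerP r 0.
  by exists [::] => // z j _; right; rewrite (le_trans r0).
have [|s [us _ sg _]] := @germ_telescope _ n g (- r) r gn; first by rewrite gtrN.
(* Because of the convention for the sign at 0, [omega] can be nonzero there even if the two germs
   coincide, so 0 is listed separately. *)
exists (undup (0 :: s)) => [|z j]; first exact: undup_uniq.
rewrite mem_undup inE negb_or => /andP[z0 zs].
have [|zr] := lerP r `|z|; [by right|left].
rewrite (omegaE _ _ gn) sg// -?ltr_norml// /sgn_right /sgn_left (negbTE z0).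
by rewrite subrr.
Qed.

Lemma root_sumE n g P s r t :
  (forall z j, z \notin s -> omega j g z = 0 \/ r <= `|z|) ->
  uniq s -> t <= r ->
  root_sum n g P t =
  \sum_(1 <= j < n.+1) \sum_(z <- s | z \in P) omega j g z * kern j t z.
Proof.
move=> sP us tr; rewrite /root_sum !big_nat; apply: eq_bigr => j /andP[j1 _].
rewrite (@fsum_seq _ _ s)// => z /(sP _ j)[->|rz]; first by rewrite mul0r.
by rewrite kern0 ?mulr0// (le_trans tr).
Qed.

Lemma horner_nderiv n p x h : (size p <= n.+1)%N ->
  p.[x + h] = p.[x] + \sum_(1 <= j < n.+1) p^`N(j).[x] * h ^+ j.
Proof.
move=> sp; rewrite (nderiv_taylor_wide _ sp); last exact: mulrC.
by rewrite big_ord_recl expr0 mulr1 nderivn0 big_add1 /= big_mkord.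
Qed.

(** Each jump at z is expanded around z and evaluated at r: the constant terms cancel by continuity,
    and the others are [omega j g z * (r - z) ^+ j], all signs being 1 for z > 0. *)
Lemma right_rep n g r : locally_poly n g -> 0 < r ->
  g r = (rgerm g 0).[r] + root_sum n g [set z | 0 < z] r.
Proof.
move=> gn r0; have [s [us s0r sg lr]] := germ_telescope gn r0.
have sP z : z \in s -> 0 < z < r by exact: s0r.
rewrite -(horner_lgerm r gn) lr hornerD; congr (_ + _).
transitivity (\sum_(z <- s) \sum_(1 <= j < n.+1) omega j g z * kern j r z).
  rewrite horner_sum !big_seq; apply: eq_bigr => z /sP/andP[z0 zr].
  have [[_ sr] [_ sl]] := (rgermP z gn, lgermP z gn).
  rewrite -{1}(subrKC z r) hornerD hornerN.
  rewrite !(horner_nderiv _ _ sr, horner_nderiv _ _ sl).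
  rewrite (horner_rgerm z gn) (horner_lgerm z gn) opprD addrACA subrr add0r -sumrB.
  apply: eq_bigr => j _; rewrite (omegaE _ _ gn) /sgn_right /sgn_left gt_eqF// gtr0_sg//.
  have -> : kern j r z = (r - z) ^+ j by rewrite kernE gtr0_norm// ltW.
  by rewrite !expr1n !mul1r mulrBl.
rewrite exchange_big; apply: eq_big_nat => j /andP[j1 _].
rewrite (fsbig_seq _ _ us); apply: fsbig_widen => z /=; first by move=> /sP/andP[].
move=> [z0 /negP zs]; have [rz|zr] := lerP r z.
  by rewrite kern0 ?mulr0 ?gtr0_norm.
by rewrite (omegaE _ _ gn) sg ?z0// /sgn_right /sgn_left gt_eqF// subrr mul0r.
Qed.

(** For z < 0 the sign (-1)^(j+1) in [omega] absorbs both the (-1)^j of (-r - z)^j and the minus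
    sign from telescoping towards 0, so the kernels are again added. *)
Lemma left_rep n g r : locally_poly n g -> 0 < r ->
  g (- r) = (lgerm g 0).[- r] + root_sum n g [set z | z < 0] r.
Proof.
move=> gn r0; have Nr0 : - r < 0 by rewrite oppr_lt0.
have [s [us s0r sg lr]] := germ_telescope gn Nr0.
have sP z : z \in s -> - r < z < 0 by exact: s0r.
rewrite -(horner_rgerm (- r) gn) lr hornerD -addrA; apply/esym/eqP.
rewrite -subr_eq0 addrAC subrr add0r; apply/eqP.
transitivity (\sum_(z <- s) ((rgerm g z - lgerm g z).[-r] +
   \sum_(1 <= j < n.+1) omega j g z * kern j r z)); last first.
  rewrite !big_seq big1// => z /sP/andP[rz z0].
  have [[_ sr] [_ sl]] := (rgermP z gn, lgermP z gn).
  rewrite -{1}(subrKC z (- r)) hornerD hornerN.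
  rewrite !(horner_nderiv _ _ sr, horner_nderiv _ _ sl).
  rewrite (horner_rgerm z gn) (horner_lgerm z gn) opprD addrACA subrr add0r.
  rewrite -sumrB -big_split big1//= => j _.
  rewrite (omegaE _ _ gn) /sgn_right /sgn_left lt_eqF// ltr0_sg//.
  have -> : kern j r z = (r + z) ^+ j.
    by rewrite kernE ltr0_norm// ?opprK// lerNl ltW.
  have -> : (- r - z) ^+ j = (- 1) ^+ j * (r + z) ^+ j.
    by rewrite -opprD (exprNn (r + z)).
  by rewrite exprS; ring.
rewrite [RHS]big_split horner_sum; congr (_ + _); rewrite exchange_big.
apply: eq_big_nat => j /andP[j1 _].
rewrite (fsbig_seq _ _ us); apply/esym/fsbig_widen => z /=; first by move=> /sP/andP[].
move=> [z0 /negP zs]; have [rz|zr] := lerP z (- r).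
  by rewrite kern0 ?mulr0 ?ltr0_norm// lerNr.
by rewrite (omegaE _ _ gn) sg ?z0 ?andbT// /sgn_right /sgn_left lt_eqF// subrr mul0r.
Qed.

(** Since the signs at 0 are 1 and -1, [omega j g 0] is exactly the sum of the coefficients of r^j
    in the right germ at r and the left germ at -r. *)
Lemma zero_rep n g r : locally_poly n g ->
  (rgerm g 0).[r] + (lgerm g 0).[- r] =
  2 * g 0 + \sum_(1 <= j < n.+1) omega j g 0 * r ^+ j.
Proof.
move=> gn; have [[_ sr] [_ sl]] := (rgermP 0 gn, lgermP 0 gn).
rewrite -[in (rgerm g 0).[r]](add0r r) -[in (lgerm g 0).[- r]](add0r (- r)).
rewrite (horner_nderiv _ _ sr) (horner_nderiv _ _ sl).
rewrite (horner_rgerm 0 gn) (horner_lgerm 0 gn) addrACA -mulr2n mulr_natl.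
congr (_ + _); rewrite -big_split; apply: eq_bigr => j _ /=.
rewrite (omegaE _ _ gn) /sgn_right /sgn_left eqxx expr1n.
by rewrite (exprNn r) exprS; ring.
Qed.

Lemma jensen n g r : locally_poly n g -> 0 < r ->
  g r + g (- r) - 2 * g 0 = root_sum n g setT r.
Proof.
move=> gn r0; rewrite (right_rep gn r0) (left_rep gn r0).
rewrite addrACA (zero_rep _ gn) addrAC (addrAC (2 * g 0)) subrr add0r.
have [s us sP] := omega_support r gn.
(* 0 is put on the list so that its term can be isolated, whether or not it is a root. *)
have ss : uniq (undup (0 :: s)) by exact: undup_uniq.
have {us} sP z j : z \notin undup (0 :: s) -> omega j g z = 0 \/ r <= `|z|.
  by rewrite mem_undup inE negb_or => /andP[_ /(sP z j)].
have s0 : 0 \in undup (0 :: s) by rewrite mem_undup mem_head.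
rewrite !(root_sumE _ _ sP ss (lexx r)) -!big_split.
apply: eq_big_nat => j /andP[j1 _] /=.
rewrite [in RHS](eq_bigl xpredT) => [|z]; last by rewrite in_setT.
rewrite [RHS](bigD1_seq 0)//= kernE normr0 ?subr0 1?ltW//; congr (_ + _).
rewrite big_mkcond [X in _ + X]big_mkcond [RHS]big_mkcond -big_split/=.
apply: eq_bigr => z _; rewrite !in_set_pred.
by case: ltgtP => _; rewrite ?addr0 ?add0r.
Qed.

End RootSum.
(** * Closure properties of piecewise polynomial functions *)

Section LocallyPoly.
Context {R : realType}.
Implicit Types (g h : R -> R) (p q : {poly R}) (x y z a b r : R).

Lemma right_germ_le g x p a : x < a ->
  (forall y, x <= y <= a -> g y = p.[y]) -> right_germ g x p.
Proof.
move=> xa gp; exists (a - x); first by rewrite subr_gt0.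
by rewrite addrC subrK.
Qed.

Lemma left_germ_ge g x p a : a < x ->
  (forall y, a <= y <= x -> g y = p.[y]) -> left_germ g x p.
Proof.
by move=> ax gp; exists (x - a); rewrite ?subr_gt0// subKr.
Qed.

Lemma right_germ2 g h x p q : right_germ g x p -> right_germ h x q ->
  exists2 e, 0 < e & forall y, x <= y <= x + e -> g y = p.[y] /\ h y = q.[y].
Proof.
move=> [d d0 gp] [e e0 hq]; exists (Num.min d e); first by rewrite lt_min d0.
move=> y /andP[xy]; rewrite -lerBlDl le_min !lerBlDl => /andP[yd ye].
by split; [apply: gp|apply: hq]; rewrite xy.
Qed.

Lemma left_germ2 g h x p q : left_germ g x p -> left_germ h x q ->
  exists2 e, 0 < e & forall y, x - e <= y <= x -> g y = p.[y] /\ h y = q.[y].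
Proof.
move=> [d d0 gp] [e e0 hq]; exists (Num.min d e); first by rewrite lt_min d0.
move=> y /andP[]; rewrite lerBlDr -lerBlDl le_min !lerBlDl -!lerBlDr.
by move=> /andP[yd ye] yx; split; [apply: gp|apply: hq]; rewrite yx andbT.
Qed.

Lemma locally_poly_shift n g c : locally_poly n g ->
  locally_poly n (fun x => g (x + c)).
Proof.
move=> gn x; have [[p [d d0 gp] sp] [q [e e0 gq] sq]] := gn (x + c).
have comp (u : {poly R}) : (size u <= n.+1)%N -> (size (u \Po ('X + c%:P))%R <= n.+1)%N.
  by rewrite size_comp_poly2 ?size_XaddC.
split.
  exists (p \Po ('X + c%:P)); last exact: comp.
  exists d => // y yx; rewrite horner_comp !hornerE gp//.
  by rewrite lerD2r addrAC lerD2r.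
exists (q \Po ('X + c%:P)); last exact: comp.
exists e => // y yx; rewrite horner_comp !hornerE gq//.
by rewrite lerD2r addrAC lerD2r.
Qed.

Lemma locally_polyD n g h : locally_poly n g -> locally_poly n h ->
  locally_poly n (fun x => g x + h x).
Proof.
move=> gn hn x; have [[p gp sp] [q gq sq]] := gn x.
have [[p' hp sp'] [q' hq sq']] := hn x; split.
  exists (p + p'); last by rewrite (leq_trans (size_polyD _ _))// geq_max sp.
  have [e e0 E] := right_germ2 gp hp; exists e => // y /E[-> ->].
  by rewrite hornerD.
exists (q + q'); last by rewrite (leq_trans (size_polyD _ _))// geq_max sq.
have [e e0 E] := left_germ2 gq hq; exists e => // y /E[-> ->].
by rewrite hornerD.
Qed.

Lemma right_germN g x p : right_germ g x p ->
  right_germ (trop_div (@trop_one R) g) x (- p).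
Proof.
move=> [e e0 gp]; exists e => // y /gp gy.
by rewrite /trop_div /trop_one sub0r gy hornerN.
Qed.

Lemma left_germN g x p : left_germ g x p ->
  left_germ (trop_div (@trop_one R) g) x (- p).
Proof.
move=> [e e0 gp]; exists e => // y /gp gy.
by rewrite /trop_div /trop_one sub0r gy hornerN.
Qed.

Lemma locally_polyN n g : locally_poly n g ->
  locally_poly n (trop_div (@trop_one R) g).
Proof.
move=> gn x; have [[p gp sp] [q gq sq]] := gn x.
by split; [exists (- p)|exists (- q)]; rewrite ?size_polyN//;
  [exact: right_germN|exact: left_germN].
Qed.

Lemma omegaN n g j x : locally_poly n g ->
  omega j (trop_div (@trop_one R) g) x = - omega j g x.
Proof.
move=> gn; rewrite (omegaE _ _ gn) (omegaE _ _ (locally_polyN gn)).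
rewrite (rgermE (right_germN (rgermP x gn).1)) (lgermE (left_germN (lgermP x gn).1)).
by rewrite !nderivnN !hornerN; ring.
Qed.

Lemma poly_pos_near p x : 0 < p.[x] -> exists2 e, 0 < e &
  forall y, `|x - y| <= e -> 0 <= p.[y].
Proof.
move=> p0; have cp : {for x, continuous (horner p)}.
  apply: differentiable_continuous; apply/derivable1_diffP.
  by have [] := is_derive_poly p x.
have /nbhs_ballP[e /= e0 pe] : \forall y \near x, 0 < p.[y].
  exact: (cvgr_gt _ cp).
exists (e / 2); first by rewrite divr_gt0.
move=> y xy; apply/ltW/pe; rewrite /ball/= (le_lt_trans xy)//.
by rewrite ltr_pdivrMr// ltr_pMr// ltr1n.
Qed.

(** Write p = q (X - x)^k with q nonzero at x: q keeps its sign near x, and the power has a constant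
    sign on each side. Applied to a difference of germs, this makes the maximum of two functions
    polynomial on each side. *)
Lemma poly_sign_near p x : exists2 e, 0 < e &
  ((forall y, x <= y <= x + e -> 0 <= p.[y]) \/
   (forall y, x <= y <= x + e -> p.[y] <= 0)) /\
  ((forall y, x - e <= y <= x -> 0 <= p.[y]) \/
   (forall y, x - e <= y <= x -> p.[y] <= 0)).
Proof.
have [->|p0] := eqVneq p 0.
  by exists 1 => //; split; left => y _; rewrite horner0.
have [k [q]] := multiplicity_XsubC p x; rewrite p0 /= => qx pE.
have [e e0 [b qe]] : exists2 e, 0 < e &
    exists b : bool, forall y, `|x - y| <= e -> 0 <= (-1) ^+ b * q.[y].
  have [q0|q0|/eqP] := ltgtP q.[x] 0; last by move: qx; rewrite /root => /negbTE->.
    have [|e e0 qe] := @poly_pos_near (- q) x; first by rewrite hornerN oppr_gt0.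
    by exists e => //; exists true => y /qe; rewrite hornerN expr1 mulN1r.
  have [e e0 qe] := poly_pos_near q0.
  by exists e => //; exists false => y /qe; rewrite expr0 mul1r.
have pyE y : p.[y] = q.[y] * (y - x) ^+ k by rewrite pE hornerM horner_exp hornerXsubC.
have sgn_case (c : bool) (A : R -> Prop) : (forall y, A y -> 0 <= (-1) ^+ c * p.[y]) ->
   (forall y, A y -> 0 <= p.[y]) \/ (forall y, A y -> p.[y] <= 0).
  case: c => H; [right|left] => y /H; first by rewrite expr1 mulN1r oppr_ge0.
  by rewrite expr0 mul1r.
exists e => //; split.
  apply: (sgn_case b) => y /andP[xy ye]; rewrite pyE mulrA mulr_ge0//.
    by apply: qe; rewrite distrC ger0_norm ?subr_ge0// lerBlDl.
  by rewrite exprn_ge0 ?subr_ge0.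
(* Left of [x] the factor (y - x)^k contributes the additional sign (-1)^k. *)
apply: (sgn_case (b (+) odd k)) => y /andP[ey yx]; rewrite pyE signr_addb.
have -> : (y - x) ^+ k = (-1) ^+ odd k * (x - y) ^+ k.
  by rewrite -(opprB x y) (exprNn (x - y)) signr_odd.
have -> : (-1) ^+ b * (-1) ^+ odd k * (q.[y] * ((-1) ^+ odd k * (x - y) ^+ k)) =
   ((-1) ^+ odd k) ^+ 2 * ((-1) ^+ b * q.[y] * (x - y) ^+ k) by ring.
rewrite sqrr_sign mul1r mulr_ge0//.
  by apply: qe; rewrite ger0_norm ?subr_ge0// lerBlDl -lerBlDr.
by rewrite exprn_ge0 ?subr_ge0.
Qed.

Lemma locally_poly_max n g h : locally_poly n g -> locally_poly n h ->
  locally_poly n (fun x => Num.max (g x) (h x)).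
Proof.
move=> gn hn x; have [[p gp sp] [q gq sq]] := gn x.
have [[p' hp sp'] [q' hq sq']] := hn x; split.
  have [e e0 E] := right_germ2 gp hp.
  have [d d0 [[P|P] _]] := poly_sign_near (p - p') x; [exists p|exists p'] => //;
    exists (Num.min d e); rewrite ?lt_min ?d0//;
    move=> y /andP[xy]; rewrite -lerBlDl le_min !lerBlDl => /andP[yd ye];
    have [-> ->] := E y (introT andP (conj xy ye));
    have := P y (introT andP (conj xy yd)); rewrite hornerD hornerN.
    by rewrite subr_ge0 => /max_l.
  by rewrite subr_le0 => /max_r.
have [e e0 E] := left_germ2 gq hq.
have [d d0 [_ [P|P]]] := poly_sign_near (q - q') x; [exists q|exists q'] => //;
  exists (Num.min d e); rewrite ?lt_min ?d0//;
  move=> y /andP[]; rewrite lerBlDr -lerBlDl le_min !lerBlDl -!lerBlDr;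
  move=> /andP[yd ye] xy;
  have [-> ->] := E y (introT andP (conj ye xy));
  have := P y (introT andP (conj yd xy)); rewrite hornerD hornerN.
  by rewrite subr_ge0 => /max_l.
by rewrite subr_le0 => /max_r.
Qed.

Lemma locally_poly_cst n c : locally_poly n (fun=> c : R).
Proof.
move=> x; split; exists c%:P; rewrite ?(leq_trans (size_polyC_leq1 _))//;
  by exists 1 => // y _; rewrite hornerC.
Qed.

Lemma locally_poly_sum n (I : Type) (s : seq I) (F : I -> R -> R) :
  (forall i, locally_poly n (F i)) ->
  locally_poly n (fun x => \sum_(i <- s) F i x).
Proof.
move=> Fn; elim: s => [|i s IHs].
  by under eq_fun do rewrite big_nil; exact: locally_poly_cst.
by under eq_fun do rewrite big_cons; exact: locally_polyD.
Qed.

Lemma locally_poly_bigmax n (I : Type) (s : seq I) (G : R -> R) (F : I -> R -> R) :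
  locally_poly n G -> (forall i, locally_poly n (F i)) ->
  locally_poly n (fun x => \big[Num.max/G x]_(i <- s) F i x).
Proof.
move=> Gn Fn; elim: s => [|i s IHs].
  by under eq_fun do rewrite big_nil.
by under eq_fun do rewrite big_cons; exact: locally_poly_max.
Qed.

Lemma locally_poly_casoratian n m (ff : 'I_m.+1 -> R -> R) :
  (forall i, locally_poly n (ff i)) -> locally_poly n (casoratian ff).
Proof.
move=> fn; have F (c : 'I_m.+1 -> nat) :
    locally_poly n (fun x => \sum_(i < m.+1) trop_shift (c i) (ff i) x).
  by apply: locally_poly_sum => i; exact: locally_poly_shift.
exact: locally_poly_bigmax.
Qed.

(** Near x the set B is finite, and a finite set without x is closed; x itself may be a
    breakpoint. *)
Lemma finite_gap (B : set R) x : (forall a b : R, finite_set (B `&` `[a, b])) ->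
  exists2 e, 0 < e & forall z, `|x - z| < e -> z != x -> ~ B z.
Proof.
move=> Bfin; pose C := (B `&` `[x - 1, x + 1]) `\ x.
have Cclosed : closed C.
  apply: (accessible_finite_set_closed.1 (@hausdorff_accessible R _)).
    exact: norm_hausdorff.
  exact: finite_setD.
have /nbhs_ballP[e /= e0 eC] : nbhs x (~` C).
  by apply: open_nbhs_nbhs; split; [exact: closed_openC|move=> []/=].
exists (Num.min e 1); first by rewrite lt_min e0 ltr01.
move=> z; rewrite lt_min => /andP[ze z1] zx Bz; apply: (eC z ze); split.
  split => //=; move: z1; rewrite in_itv/= distrC ltr_distl => /andP[lz zr].
  by rewrite !ltW.
by move=> /= /eqP; rewrite (negbTE zx).
Qed.

Lemma piecewise_locally_poly n (P : {poly R} -> Prop) g :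
  (forall p, P p -> (size p <= n.+1)%N) -> piecewise_poly P g -> locally_poly n g.
Proof.
move=> Pn [_ [B [Bfin Bp]]] x; have [e e0 eB] := finite_gap x Bfin.
have xe : x < x + e by rewrite ltrDl.
have ex : x - e < x by rewrite gtrBl.
split.
  have [z /andP[xz ze]|p Pp gp] := Bp _ _ xe.
    by apply: eB; rewrite ?gt_eqF// distrC gtr0_norm ?subr_gt0// ltrBlDl.
  by exists p; [exact: right_germ_le gp|exact: Pn].
have [z /andP[ez zx]|p Pp gp] := Bp _ _ ex.
  by apply: eB; rewrite ?lt_eqF// gtr0_norm ?subr_gt0// ltrBlDl -ltrBlDr.
by exists p; [exact: left_germ_ge gp|exact: Pn].
Qed.

Lemma trop_meromorphic_locally_poly d n g : (d <= n)%N ->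
  trop_meromorphic d g -> locally_poly n g.
Proof.
case: d => [_ [c gc]|d dn [gd _]].
  by rewrite (_ : g = fun=> c); [exact: locally_poly_cst|exact/funext].
by apply: piecewise_locally_poly gd => p /leq_trans; exact.
Qed.

End LocallyPoly.
(** * Counting functions and shifts *)

Section Counting.
Context {R : realType}.
Implicit Types (f g : R -> R) (x y z w a b r : R) (P W : set R) (s : seq R).

Lemma fsum_sub (A P : set R) (F G : R -> R) : A `<=` P ->
  (forall z, A z -> F z = G z) -> (forall z, P z -> ~ A z -> G z = 0) ->
  \sum_(z \in A) F z = \sum_(z \in P) G z.
Proof.
move=> AP FG G0; rewrite (eq_fsbigr G) => [|z /set_mem/FG//].
by apply: fsbig_widen => // z [/G0].
Qed.

Lemma pole_sum j r P g : (0 < j)%N ->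
  \sum_(z \in [set z | [/\ - r < z < r, P z & trop_pole j g z]])
    (trop_mult j g z * (r - `|z|) ^+ j) =
  \sum_(z \in P) Num.max (- omega j g z) 0 * kern j r z.
Proof.
move=> j0; apply: fsum_sub => [z []//|z [zr _ w0]|z Pz nA].
  rewrite /trop_mult ltr0_norm// max_l ?oppr_ge0 ?ltW// kernE//.
  by rewrite ltW// ltr_norml.
have [zr|rz] := ltP `|z| r; last by rewrite kern0// mulr0.
have [w0|w0] := ltP (omega j g z) 0; last by rewrite max_r ?mul0r// oppr_le0.
by exfalso; apply: nA; split => //; rewrite -ltr_norml.
Qed.

Lemma NcountE j r g : (0 < j)%N -> Ncount j r g =
  2^-1 * \sum_(z \in setT) Num.max (- omega j g z) 0 * kern j r z.
Proof.
move=> j0; rewrite -pole_sum// /Ncount; congr (_ * _); apply: eq_fsbigl.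
by apply/seteqP; split => z []//= zr [].
Qed.

Lemma Ncount_opp n j r g : locally_poly n g -> (0 < j)%N ->
  Ncount j r (trop_div (@trop_one R) g) =
  2^-1 * \sum_(z \in setT) Num.max (omega j g z) 0 * kern j r z.
Proof.
move=> gn j0; rewrite NcountE//; congr (_ * _); apply: eq_fsbigr => z _.
by rewrite (omegaN _ _ gn) opprK.
Qed.

Lemma Ncount_on_opp n j a b r g : locally_poly n g -> (0 < j)%N ->
  Ncount_on j a b r (trop_div (@trop_one R) g) =
  2^-1 * \sum_(z \in [set z | a <= z <= b]) Num.max (omega j g z) 0 * kern j r z.
Proof.
move=> gn j0; rewrite /Ncount_on pole_sum//; congr (_ * _).
by apply: eq_fsbigr => z _; rewrite (omegaN _ _ gn) opprK.
Qed.

(** The poles of -g are the roots of g, so the two counting functions carry the positive and the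
    negative part of [omega]; their difference is half the Jensen sum. *)
Lemma Ncount_jensen n r g : locally_poly n g ->
  \sum_(1 <= j < n.+1) Ncount j r (trop_div (@trop_one R) g) =
  \sum_(1 <= j < n.+1) Ncount j r g + 2^-1 * root_sum n g setT r.
Proof.
move=> gn; have [s us sP] := omega_support r gn.
rewrite /root_sum mulr_sumr -big_split; apply: eq_big_nat => j /andP[j1 _] /=.
have Fs (F : R -> R) : (forall z, omega j g z = 0 -> F z = 0) ->
    \sum_(z \in setT) F z * kern j r z = \sum_(z <- s) F z * kern j r z.
  move=> F0; rewrite (@fsum_seq _ _ _ s)// => [|z /(sP z j)[/F0->|rz]].
  - by apply: eq_bigl => z; rewrite in_setT.
  - by rewrite mul0r.
  - by rewrite kern0 ?mulr0.
rewrite (Ncount_opp _ gn)// NcountE// !Fs//; last 2 first.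
- by move=> z ->; rewrite oppr0 maxxx.
- by move=> z ->; rewrite maxxx.
rewrite -mulrDr -big_split; congr (_ * _); apply: eq_bigr => z _ /=.
rewrite -mulrDl; congr (_ * _).
case: (lerP (omega j g z) 0) => w0.
  by rewrite max_l ?oppr_ge0// addNr.
by rewrite max_r ?add0r// oppr_le0 ltW.
Qed.

Lemma iter_right_derive_shift g c j x :
  iter j (@right_derive R) (fun y => g (y + c)) x =
  iter j (@right_derive R) g (x + c).
Proof.
elim: j x => // j IHj x; rewrite !iterS /right_derive.
by under eq_fun do rewrite !IHj addrAC.
Qed.

Lemma iter_left_derive_shift g c j x :
  iter j (@left_derive R) (fun y => g (y + c)) x =
  iter j (@left_derive R) g (x + c).
Proof.
elim: j x => // j IHj x; rewrite !iterS /left_derive.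
by under eq_fun do rewrite !IHj addrAC.
Qed.

Lemma sgn_right_odd j x : odd j -> sgn_right x ^+ j.+1 = 1.
Proof.
move=> oj; rewrite /sgn_right; have [_|x0] := eqVneq x 0; first by rewrite expr1n.
have [k ->] : exists k, j.+1 = (2 * k)%N.
  by exists j.+1./2; rewrite mul2n even_halfK//= oj.
by rewrite exprM sqr_sg x0 expr1n.
Qed.

Lemma sgn_left_odd j x : odd j -> sgn_left x ^+ j.+1 = 1.
Proof.
move=> oj; have -> : sgn_left x ^+ j.+1 = sgn_right x ^+ j.+1.
  rewrite /sgn_left /sgn_right; case: eqP => // _.
  by rewrite -signr_odd /= oj expr1n.
exact: sgn_right_odd.
Qed.

(** A shift moves the derivatives from z to z + k but evaluates the sign factors at z. They are
    unaffected if j + 1 is even or if z and z + k lie on the same side of 0; the remaining z lie in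
    [-k, 0], inside the window of the theorem. *)
Lemma omega_shift j k g z :
  odd j \/ 0 < z \/ z + k%:R < 0 \/ k = 0%N ->
  omega j (trop_shift k g) z = omega j g (z + k%:R).
Proof.
move=> H; rewrite /omega iter_right_derive_shift iter_left_derive_shift.
case: H => [oj|H]; first by rewrite !(sgn_right_odd _ oj) !(sgn_left_odd _ oj).
have k0 : 0 <= k%:R :> R by rewrite ler0n.
case: H => [z0|[zk|->]]; last by rewrite addr0.
- have zk0 : 0 < z + k%:R by rewrite ltr_pwDl.
  by rewrite /sgn_right /sgn_left !gt_eqF// !gtr0_sg.
- have z0 : z < 0 by rewrite (le_lt_trans _ zk)// lerDl.
  by rewrite /sgn_right /sgn_left !lt_eqF// !ltr0_sg.
Qed.

(** Here [n] only bounds the degree, so that all coordinates of a curve are entire for one common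
    [n]. *)
Definition entire n g : Prop :=
  locally_poly n g /\ forall j z, (0 < j)%N -> 0 <= omega j g z.

Lemma trop_entire_entire d n g : (d <= n)%N -> trop_entire d g -> entire n g.
Proof.
move=> dn [gd gp]; split; first exact: trop_meromorphic_locally_poly gd.
by move=> j z j0; have /negP := gp j z j0; rewrite -leNgt.
Qed.

Lemma shift_sum_le n f j (k : nat) r W : entire n f -> (0 < j)%N ->
  (forall w, W w -> omega j (trop_shift k f) (w - k%:R) = omega j f w) ->
  `|\sum_(z \in [set z | W (z + k%:R)])
        Num.max (omega j (trop_shift k f) z) 0 * kern j r z -
    \sum_(w \in W) omega j f w * kern j r w| <=
  \sum_(w \in setT) omega j f w * kern j (r + k%:R) w -
  \sum_(w \in setT) omega j f w * kern j (r - k%:R) w.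
Proof.
move=> [fn f0] j0 WE; set K : R := k%:R.
have K0 : 0 <= K by rewrite ler0n.
have [s us sP] := omega_support (r + K) fn.
rewrite (@reindex_fsbig _ _ _ _ _ (fun w => w - K) W); last first.
  split => [w /=|z w _ _ /addIr//|z /= Wz]; first by rewrite subrK.
  by exists (z + K); rewrite ?addrK.
(* The shifted function may have poles, hence the positive part; on [W] its [omega] is that of [f],
   which is nonnegative. *)
have -> : \sum_(w \in W) Num.max (omega j (trop_shift k f) (w - K)) 0 *
    kern j r (w - K) = \sum_(w \in W) omega j f w * kern j r (w - K).
  by apply: eq_fsbigr => w /set_mem/WE ->; rewrite max_l// f0.
have kw w : r - `|w - K| <= r + K - `|w| /\ r - K - `|w| <= r - `|w - K|.
  have := ler_distD 0 w K; have := ler_normB w K.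
  have := lerB_dist w K; rewrite (ger0_norm K0) => H1 H2 _; split; lra.
have Fs P (F : R -> R) : (forall z, r + K <= `|z| -> F z = 0) ->
    \sum_(z \in P) omega j f z * F z = \sum_(z <- s | z \in P) omega j f z * F z.
  move=> F0; rewrite (@fsum_seq _ _ _ s)// => z /(sP z j)[->|/F0->].
    by rewrite mul0r.
  by rewrite mulr0.
have kz x z : x <= r + K -> r + K <= `|z| -> kern j x z = 0.
  by move=> xr rz; rewrite kern0// (le_trans xr).
have rK : r <= r + K by rewrite lerDl.
have NK : r - K <= r + K by rewrite (le_trans _ rK)// gerBl.
have kA z : r + K <= `|z| -> kern j r (z - K) = 0.
  by move=> rz; rewrite kern0// -subr_le0 (le_trans (kw z).1)// subr_le0.
rewrite (Fs W (fun w => kern j r (w - K)) kA) (Fs W _ (fun z => kz r z rK)).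
rewrite (Fs setT _ (fun z => kz (r + K) z (lexx _))).
rewrite (Fs setT _ (fun z => kz (r - K) z NK)).
rewrite -!sumrB (le_trans (ler_norm_sum _ _ _))// big_mkcond [leRHS]big_mkcond.
apply: ler_sum => z _; rewrite in_setT.
have w0 := f0 j z j0.
have [H1 H2] := kw z.
rewrite -!mulrBr; case: ifP => _; last first.
  by rewrite mulr_ge0// subr_ge0 le_kern// lerD2r (le_trans _ rK)// gerBl.
rewrite normrM (ger0_norm w0) ler_wpM2l// ler_norml.
have := @le_kern _ j (r - K) r z (z - K) H2.
have := @le_kern _ j r (r + K) (z - K) z H1.
have : kern j (r - K) z <= kern j r z by rewrite le_kern// lerD2r gerBl.
have : kern j r z <= kern j (r + K) z by rewrite le_kern// lerD2r.
by move=> ? ? ? ?; apply/andP; split; lra.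
Qed.

Lemma fsum_split s P (F : R -> R) : uniq s -> (forall z, z \notin s -> F z = 0) ->
  \sum_(z \in setT) F z = \sum_(z \in P) F z + \sum_(z \in ~` P) F z.
Proof.
move=> us F0; rewrite !(fsum_seq _ us F0) (bigID (mem P))/=; congr (_ + _).
  by apply: eq_bigl => z; rewrite in_setT.
by apply: eq_bigl => z; rewrite in_setT in_setC.
Qed.

Lemma Ncount_entire n f j r : entire n f -> (0 < j)%N ->
  Ncount j r (trop_div (@trop_one R) f) =
  2^-1 * \sum_(w \in setT) omega j f w * kern j r w.
Proof.
move=> [fn f0] j0; rewrite (Ncount_opp _ fn)//; congr (_ * _).
by apply: eq_fsbigr => z _; rewrite max_l// f0.
Qed.

Lemma Ncount_shift_odd n f j (k : nat) r : entire n f -> odd j ->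
  `|Ncount j r (trop_div (@trop_one R) (trop_shift k f)) -
    Ncount j r (trop_div (@trop_one R) f)| <=
  Ncount j (r + k%:R) (trop_div (@trop_one R) f) -
  Ncount j (r - k%:R) (trop_div (@trop_one R) f).
Proof.
move=> fe oj; have j0 : (0 < j)%N by case: j oj.
have sn : locally_poly n (trop_shift k f) by exact: locally_poly_shift fe.1.
rewrite !(Ncount_entire _ fe)// (Ncount_opp _ sn)// -!mulrBr normrM.
rewrite ger0_norm ?invr_ge0// ler_wpM2l ?invr_ge0//.
have := @shift_sum_le n f j k r setT fe j0; apply => w _.
by rewrite omega_shift ?subrK//; left.
Qed.

(** Both sums are split at the window, [-2k, 0] for the shift and [-k, k] for f. Inside, the
    difference is kept as it stands; outside, [omega_shift] and [shift_sum_le] apply. *)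
Lemma Ncount_shift_even n f j (k : nat) r : entire n f -> (0 < j)%N ->
  `|Ncount j r (trop_div (@trop_one R) (trop_shift k f)) -
    Ncount j r (trop_div (@trop_one R) f)| <=
  `|Ncount_on j (- (2 * k)%N%:R) 0 r (trop_div (@trop_one R) (trop_shift k f)) -
    Ncount_on j (- k%:R) k%:R r (trop_div (@trop_one R) f)| +
  (Ncount j (r + k%:R) (trop_div (@trop_one R) f) -
   Ncount j (r - k%:R) (trop_div (@trop_one R) f)).
Proof.
move=> fe j0.
have sn : locally_poly n (trop_shift k f) by exact: locally_poly_shift fe.1.
pose W : set R := ~` [set w | - k%:R <= w <= k%:R].
pose Z : set R := [set z | - (2 * k)%N%:R <= z <= 0].
have k0 : 0 <= k%:R :> R by rewrite ler0n.
have ZW : ~` Z = [set z | W (z + k%:R)].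
  apply/seteqP; split => z /=; rewrite /Z /W /= => H H'; apply: H;
    move: H' => /andP[H1 H2]; rewrite natrM in H1 *; apply/andP; split; lra.
have := @shift_sum_le n f j k r W fe j0.
rewrite -ZW.
have -> : \sum_(w \in W) omega j f w * kern j r w =
    \sum_(w \in W) Num.max (omega j f w) 0 * kern j r w.
  by apply: eq_fsbigr => z _; rewrite max_l// fe.2.
set A := \sum_(z \in ~` Z) _; set B := \sum_(w \in W) _.
move=> AB.
have {}AB : `|A - B| <= \sum_(w \in setT) omega j f w * kern j (r + k%:R) w -
    \sum_(w \in setT) omega j f w * kern j (r - k%:R) w.
  apply: AB => w /=; rewrite /W/= => /negP; rewrite negb_and -!ltNge => /orP H.
  rewrite omega_shift ?subrK//; right.
  by case: H => H; [right; left; rewrite (lt_le_trans H)// oppr_le0|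
    left; rewrite subr_gt0].
rewrite !(Ncount_entire _ fe)// !(Ncount_on_opp _ _ _ sn)//.
rewrite (Ncount_on_opp _ _ _ fe.1)// (Ncount_opp _ sn)//.
have {}AB : 2^-1 * `|A - B| <=
    2^-1 * \sum_(w \in setT) omega j f w * kern j (r + k%:R) w -
    2^-1 * \sum_(w \in setT) omega j f w * kern j (r - k%:R) w.
  by rewrite -mulrBr ler_wpM2l// invr_ge0.
apply: le_trans (lerD (lexx _) AB).
have split (g : R -> R) P : locally_poly n g ->
    \sum_(z \in setT) Num.max (omega j g z) 0 * kern j r z =
    \sum_(z \in P) Num.max (omega j g z) 0 * kern j r z +
    \sum_(z \in ~` P) Num.max (omega j g z) 0 * kern j r z.
  move=> gn; have [s us sP] := omega_support r gn.
  apply: (@fsum_split s) => // z /(sP z j)[->|rz]; first by rewrite maxxx mul0r.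
  by rewrite kern0 ?mulr0.
have -> : \sum_(w \in setT) omega j f w * kern j r w =
    \sum_(w \in setT) Num.max (omega j f w) 0 * kern j r w.
  by apply: eq_fsbigr => z _; rewrite max_l// fe.2.
rewrite (split _ Z sn) (split _ [set w | - k%:R <= w <= k%:R] fe.1).
rewrite -/A -/B -!mulrBr !normrM (ger0_norm (_ : 0 <= 2^-1)) ?invr_ge0//.
rewrite -mulrDr ler_wpM2l ?invr_ge0// opprD addrACA; exact: ler_normD.
Qed.

End Counting.
(** * A Borel-type growth lemma *)

Section Growth.
Context {R : realType}.
Implicit Types (x y r : R).

(** The block [k, k + 1[ has logarithmic measure at most 1/k, hence at most [W k - W k.+1]; these
    bounds telescope to at most [W 0]. *)
Lemma finite_log_measure_blocks (I : pred nat) (W : nat -> R) :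
  (forall k, 0 <= W k) -> (forall k, W k.+1 <= W k) ->
  (forall k, I k -> (0 < k)%N /\ k%:R^-1 <= W k - W k.+1) ->
  finite_log_measure (\bigcup_(k in [set k | I k]) `[(k%:R : R), k.+1%:R[%classic).
Proof.
move=> W0 Wd IW; set E := \bigcup_(k in _) _.
pose F k : set R := if I k then `[k%:R, k.+1%:R[%classic else set0.
have EF : E = \bigcup_k F k.
  apply/seteqP; split => x [k /= Ik xk].
    by exists k => //; rewrite /F Ik.
  by exists k; move: xk; rewrite /F/=; case: (I k).
have Fm k : measurable (F k).
  by rewrite /F; case: ifP => _; [exact: measurable_itv|exact: measurable0].
have Em : measurable E by rewrite EF; exact: bigcup_measurable.
have E1 x : E x -> 1 <= x.
  move=> [k /= /IW[k0 _]]; rewrite in_itv/= => /andP[+ _].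
  by apply: le_trans; rewrite ler1n.
split => //.
  by move=> x /E1 x1; rewrite /= in_itv/= (lt_le_trans ltr01 x1).
have -> : E `&` `[1%R, +oo[ = E.
  by apply/setIidl => x /E1; rewrite /= in_itv/= andbT.
have fm (D : set R) : (forall x, D x -> 0 <= x) ->
    measurable_fun D (EFin \o (fun x : R => x^-1)).
  move=> D0; apply/measurable_EFinP; apply: (eq_measurable_fun (@powR R ^~ (-1))).
    by move=> x /set_mem/D0 x0; rewrite powR_inv1.
  by apply: measurable_funTS; exact: measurable_powR.
rewrite EF ge0_integral_bigcup//; last 3 first.
- by rewrite -EF; apply: fm => x /E1; exact: le_trans.
- move=> x [k _]; rewrite /F; case: ifP => // _; rewrite /= in_itv/= => /andP[kx _].
  by rewrite lee_fin invr_ge0 (le_trans _ kx).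
- move=> i j _ _ [x []]; rewrite /F; case: ifP => // _; case: ifP => // _.
  rewrite /= !in_itv/= => /andP[ix xi] /andP[jx xj].
  have := le_lt_trans ix xj; have := le_lt_trans jx xi.
  by rewrite !ltr_nat !ltnS => ij ji; apply/eqP; rewrite eqn_leq ij ji.
have FW k : (\int[lebesgue_measure]_(x in F k) (x^-1)%:E <= (W k - W k.+1)%:E)%E.
  rewrite /F; case: ifP => [Ik|_]; last by rewrite integral_set0 lee_fin subr_ge0.
  have [k0 kW] := IW _ Ik; apply: (@le_trans _ _ (k%:R^-1)%:E); last by rewrite lee_fin.
  have <- : (\int[lebesgue_measure]_(x in `[k%:R, k.+1%:R[) (cst (k%:R^-1 : R)%:E x) =
      (k%:R^-1)%:E)%E.
    rewrite integral_cst//= lebesgue_measure_itv/= lte_fin ltr_nat ltnSn.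
    by rewrite -EFinD -natrB// subSnn mule1.
  apply: ge0_le_integral => //.
  - move=> x; rewrite /= in_itv/= => /andP[kx _].
    by rewrite lee_fin invr_ge0 (le_trans _ kx).
  - by apply: fm => x; rewrite /= in_itv/= => /andP[kx _]; rewrite (le_trans _ kx).
  - move=> x; rewrite /= in_itv/= => /andP[kx _].
    rewrite lee_fin lef_pV2 ?posrE ?ltr0n//.
    by rewrite (lt_le_trans _ kx)// ltr0n.
apply: (@le_lt_trans _ _ (W 0)%:E); last exact: ltry.
apply: lime_le.
  apply: is_cvg_nneseries => k _ _; apply: integral_ge0 => x.
  rewrite /F; case: ifP => // _; rewrite /= in_itv/= => /andP[kx _].
  by rewrite lee_fin invr_ge0 (le_trans _ kx).
apply: nearW => n; apply: le_trans (lee_sum _ (fun i _ => FW i)) _.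
rewrite sumEFin lee_fin; apply: (@le_trans _ _ (W 0 - W n)); last first.
  by rewrite gerBl.
elim: n => [|n IHn]; first by rewrite big_geq// subrr.
by rewrite big_nat_recr//= (le_trans (lerD IHn (lexx _)))// addrA subrK.
Qed.

Lemma powR_small (a e : R) : 0 < a -> 0 < e -> \forall r \near +oo, r `^ (- a) <= e.
Proof.
move=> a0 e0; near=> r.
have r0 : 0 < r by near: r; exact: nbhs_pinfty_gt.
have er : e^-1 `^ a^-1 <= r by near: r; apply: nbhs_pinfty_ge; exact: num_real.
rewrite powRN -[e]invrK lef_pV2 ?posrE ?invr_gt0 ?powR_gt0//.
have e1 : 0 <= e^-1 by rewrite invr_ge0 ltW.
rewrite -[leLHS](powRr1 e1) -(mulVf (lt0r_neq0 a0)) powRrM.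
by rewrite ge0_ler_powR ?nnegrE ?powR_ge0// ltW.
Unshelve. all: by end_near. Qed.

(* Divided by [y `^ (1 + d)], the increment becomes bounded by a telescoping one:
   this is the Borel trick of integrating dv / v^(1 + d). *)
Lemma powRN_increment (d x y : R) : 0 < d -> 0 < x <= y ->
  y - x <= y `^ (1 + d) / d * (x `^ (- d) - y `^ (- d)).
Proof.
move=> d0 /andP[x0 xy]; have y0 : 0 < y by exact: lt_le_trans xy.
have [x0' y0'] := (ltW x0, ltW y0).
rewrite mulrAC ler_pdivlMr// powRD ?(gt_eqF y0) ?implybT// powRr1//.
rewrite mulrBr -[y * _ * y `^ - d]mulrA -powRD ?(gt_eqF y0) ?implybT//.
rewrite subrr powRr0 mulr1.
(* By homogeneity only t = x / y matters, and the claim becomes 1 + d (1 - t) <= t^(-d). It follows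
   from exp(s) >= 1 + s at s = -d ln t together with ln t <= t - 1. *)
have -> : y * y `^ d * x `^ (- d) = y * (x / y) `^ (- d).
  by rewrite -mulrA mulrC powRM ?invr_ge0// -powR_inv1// -powRrM mulrNN mul1r; ring.
have xy0 : 0 < x / y by rewrite divr_gt0.
have : 1 + d * (1 - x / y) <= (x / y) `^ (- d).
  rewrite /powR gt_eqF// (le_trans _ (expR_ge1Dx _))// lerD2l mulNr -mulrN.
  rewrite ler_pM2l//; have := @le_ln1Dx _ (x / y - 1).
  have -> : 1 + (x / y - 1) = x / y by ring.
  by rewrite ltrBrDl subrr => /(_ xy0); lra.
rewrite -(ler_pM2l y0) => H; rewrite lerBrDr; apply: le_trans H.
rewrite le_eqVlt; apply/orP; left; apply/eqP; field.
by rewrite gt_eqF.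
Qed.

(** Off the exceptional blocks the decrease of u^(-d) across the window is O(1/r). By
    [powRN_increment] the increment of u is then O(r^(rho (1 + d) - 1)), and d is small enough for
    this exponent to be below -sigma. *)
Lemma increment_small (u : R -> R) (m : nat) (C rho sigma : R) :
  {homo u : x y / x <= y} -> (forall x, 1 <= u x) ->
  0 <= rho -> rho + sigma < 1 -> (\forall r \near +oo, u r <= C * r `^ rho) ->
  exists2 E, finite_log_measure E & forall e, 0 < e ->
    \forall r \near +oo, ~ E r -> u (r + m%:R) - u (r - m%:R) <= e * r `^ (- sigma).
Proof.
move=> umono u1 rho0 rs uC.
have u0 x : 0 < u x by exact: lt_le_trans (u1 x).
(* This choice gives rho d <= (1 - rho - sigma) / 2, hence tau + sigma < 1; the denominator rho + 1
   admits rho = 0. *)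
pose d := (1 - rho - sigma) / (2 * (rho + 1)).
have d0 : 0 < d by rewrite divr_gt0 ?mulr_gt0//; lra.
pose tau := rho * (1 + d).
have taus : 0 < 1 - tau - sigma.
  have : rho * d <= (1 - rho - sigma) / 2.
    have -> : rho * d = (1 - rho - sigma) / 2 * (rho / (rho + 1)).
      by rewrite /d; field; rewrite gt_eqF//; lra.
    rewrite ler_piMr//; first by lra.
    by rewrite ler_pdivrMr; lra.
  by rewrite /tau mulrDr mulr1; lra.
(* The exceptional blocks [k, k + 1[ are those where 1 / k is dominated by the
   increment of the bounded monotone sequence W. *)
pose w k := u (k%:R - m%:R) `^ (- d).
have w0 k : 0 <= w k by exact: powR_ge0.
(* For k <= r < k + 1 the points r - m and r + m lie in [k - m, k + 1 + m], of length [q]. Summing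
   [q] consecutive terms makes one step of [W] equal to the decrease of [w] across this interval. *)
pose q := (2 * m).+1.
have wd k l : (k <= l)%N -> w l <= w k.
  move=> kl; rewrite /w !powRN lef_pV2 ?posrE ?powR_gt0//.
  by rewrite ge0_ler_powR ?nnegrE ?(ltW d0) ?(ltW (u0 _))// umono// lerD2r ler_nat.
pose W k := \sum_(k <= i < k + q) w i.
have WS k : W k - W k.+1 = w k - w (k + q)%N.
  have : w k + W k.+1 = W k + w (k + q)%N.
    rewrite /W addSn -big_ltn ?ltnS ?leq_addr//.
    by rewrite big_nat_recr ?leq_addr.
  by move=> H; lra.
have Wd k : W k.+1 <= W k by rewrite -subr_ge0 WS subr_ge0 wd ?leq_addr.
have W0 k : 0 <= W k by rewrite sumr_ge0.
pose I k := (0 < k)%N && (k%:R^-1 <= W k - W k.+1).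
exists (\bigcup_(k in [set k | I k]) `[(k%:R : R), k.+1%:R[%classic).
  by apply: (finite_log_measure_blocks W0 Wd) => k /andP[].
move=> e e0.
have C0 : 0 <= C.
  near (@pinfty_nbhs R) => r; have r0 : 0 < r by near: r; exact: nbhs_pinfty_gt.
  have : u r <= C * r `^ rho by near: r.
  by move=> /(lt_le_trans (u0 r)); rewrite pmulr_lgt0 ?powR_gt0// => /ltW.
(* The factor 3 comes from k + 1 + m <= 3 r, valid once r >= m + 1. *)
pose C1 := (C * 3 `^ rho) `^ (1 + d).
have C10 : 0 <= C1 by exact: powR_ge0.
have C2 : 0 < 2 * C1 + 1 by rewrite ltr_wpDl// mulr_ge0.
have e1 : 0 < e * d / (2 * C1 + 1) by rewrite divr_gt0// mulr_gt0.
have [M [_ MC]] := uC.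
near=> r => rE.
have r1 : 1 <= r by near: r; apply: nbhs_pinfty_ge; exact: num_real.
have r0 : 0 < r by exact: lt_le_trans r1.
have rm : m.+1%:R <= r by near: r; apply: nbhs_pinfty_ge; exact: num_real.
have rM : M < r by near: r; apply: nbhs_pinfty_gt; exact: num_real.
have re : r `^ (- (1 - tau - sigma)) <= e * d / (2 * C1 + 1).
  by near: r; exact: powR_small.
pose k := Num.truncn r.
have /andP[kr rk] : k%:R <= r < k.+1%:R by exact: truncn_itv (ltW r0).
have k0 : (0 < k)%N by rewrite truncn_gt0.
have nI : W k - W k.+1 < k%:R^-1.
  rewrite ltNge; apply/negP => kW; apply: rE; exists k; first by rewrite /= /I k0.
  by rewrite /= in_itv/= kr.
rewrite WS in nI.
set V := u (k.+1%:R + m%:R); set v := u (k%:R - m%:R).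
have wq : w (k + q)%N = V `^ (- d).
  rewrite /w /V; congr (u _ `^ _); rewrite natrD /q -!natr1 natrM; ring.
have uVv : u (r + m%:R) - u (r - m%:R) <= V - v.
  by rewrite lerB// umono// lerD2r// ltW.
apply: le_trans uVv _.
have vV : 0 < v <= V.
  rewrite u0 umono// lerD ?ler_nat//.
  by apply: (@le_trans _ _ 0); rewrite ?oppr_le0 ler0n.
apply: (le_trans (powRN_increment d0 vV)).
have V1 : V `^ (1 + d) <= C1 * r `^ tau.
  have VC : V <= C * 3 `^ rho * r `^ rho.
    apply: le_trans (MC _ _) _.
      by rewrite (lt_trans rM)// (lt_le_trans rk)// lerDl.
    rewrite -mulrA -powRM ?(ltW r0)// ler_wpM2l// ge0_ler_powR ?nnegrE//.
    - by rewrite mulr_ge0// ltW.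
    - by rewrite -natr1; move: rm; rewrite -natr1; lra.
  have A0 : 0 <= C * 3 `^ rho by rewrite mulr_ge0// powR_ge0.
  have B0 : 0 <= r `^ rho by exact: powR_ge0.
  have -> : C1 * r `^ tau = (C * 3 `^ rho * r `^ rho) `^ (1 + d).
    by rewrite /C1 /tau powRrM (powRM _ A0 B0).
  have AB0 : 0 <= C * 3 `^ rho * r `^ rho by rewrite mulr_ge0.
  have d1 : 0 <= 1 + d by rewrite addr_ge0// ltW.
  exact: (ge0_ler_powR d1 (ltW (u0 _) : V \in Num.nneg) (AB0 : _ \in Num.nneg)).
have r2 : k%:R^-1 <= 2 / r.
  have k0' : 0 < k%:R :> R by rewrite ltr0n.
  rewrite ler_pdivlMr// mulrC ler_pdivrMr//.
  have : 1 <= k%:R :> R by rewrite ler1n.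
  by move: rk; rewrite -natr1; lra.
have nI2 : v `^ (- d) - V `^ (- d) <= 2 / r by rewrite -wq (le_trans (ltW nI)).
have nI0 : 0 <= v `^ (- d) - V `^ (- d) by rewrite -wq subr_ge0 wd ?leq_addr.
apply: (@le_trans _ _ (C1 * r `^ tau / d * (2 / r))).
  apply: ler_pM => //; first by rewrite divr_ge0 ?powR_ge0// ltW.
  by rewrite ler_wpM2r// invr_ge0 ltW.
have -> : C1 * r `^ tau / d * (2 / r) =
    2 * C1 / d * r `^ (- (1 - tau - sigma)) * r `^ (- sigma).
  rewrite -[RHS]mulrA -powRD; last by rewrite (gt_eqF r0) implybT.
  have -> : - (1 - tau - sigma) + - sigma = tau - 1 by ring.
  rewrite powRB; last by rewrite (gt_eqF r0) implybT.
  by rewrite powRr1 ?(ltW r0)//; ring.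
rewrite ler_wpM2r ?powR_ge0//.
have cd0 : 0 <= 2 * C1 / d by apply: divr_ge0; [exact: mulr_ge0|exact: ltW].
apply: le_trans (ler_wpM2l cd0 re) _.
have -> : 2 * C1 / d * (e * d / (2 * C1 + 1)) = e * (2 * C1 / (2 * C1 + 1)).
  by field; rewrite !gt_eqF.
by rewrite ler_piMr ?(ltW e0)// ler_pdivrMr// mul1r lerDl.
Unshelve. all: by end_near. Qed.

(** [increment_small] is applied to ln S, which is at least 1. If ln S increases by at most D <=
    1/2, then S(r + m) - S(r - m) <= D S(r + m), and S(r + m) <= 2 S(r). *)
Lemma expR_increment_small (S : R -> R) (m : nat) (C rho sigma : R) :
  {homo S : x y / x <= y} -> (forall x, expR 1 <= S x) ->
  0 <= rho -> rho + sigma < 1 -> 0 <= sigma ->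
  (\forall r \near +oo, ln (S r) <= C * r `^ rho) ->
  exists2 E, finite_log_measure E & forall e, 0 < e ->
    \forall r \near +oo, ~ E r -> S (r + m%:R) - S (r - m%:R) <= e * r `^ (- sigma) * S r.
Proof.
move=> Smono S1 rho0 rs s0 SC.
have S0 x : 0 < S x by rewrite (lt_le_trans _ (S1 x))// expR_gt0.
have u1 x : 1 <= ln (S x) by rewrite -[1](@expRK R) ler_ln ?posrE ?expR_gt0.
have umono : {homo (fun x => ln (S x)) : x y / x <= y}.
  by move=> x y xy; rewrite ler_ln ?posrE// Smono.
have [E mE uE] := increment_small m umono u1 rho0 rs SC.
(* The half of [e] pays for the factor 2 in S(r + m) <= 2 S(r); the bound 1/2 gives D <= 1/2, since
   r^(-sigma) <= 1 for r >= 1. *)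
exists E => // e e0; pose d := Num.min (e / 2) (2^-1).
have d0 : 0 < d by rewrite lt_min divr_gt0//= invr_gt0.
near=> r => rE.
have : ln (S (r + m%:R)) - ln (S (r - m%:R)) <= d * r `^ (- sigma).
  by move: rE; near: r; exact: (uE _ d0).
have r1 : 1 <= r by near: r; apply: nbhs_pinfty_ge; exact: num_real.
have r0 : 0 < r by exact: lt_le_trans r1.
set D := d * _ => uD.
have D2 : D <= 2^-1.
  apply: (@le_trans _ _ d); last by rewrite ge_min lexx orbT.
  rewrite /D ler_piMr ?(ltW d0)// powRN invf_le1 ?powR_gt0//.
  have p1 : (1 : R) `^ sigma = 1 by rewrite powR1.
  by rewrite -[leLHS]p1 ge0_ler_powR ?nnegrE// ltW.
have SmSr : S (r - m%:R) <= S r by rewrite Smono// gerBl.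
have H : S (r + m%:R) * (1 - D) <= S (r - m%:R).
  have e1 : expR (- D) <= S (r - m%:R) / S (r + m%:R).
    rewrite -(lnK (_ : S (r - m%:R) / S (r + m%:R) \is Num.pos)) ?posrE ?divr_gt0//.
    by rewrite ler_expR ln_div ?posrE// lerNl opprB.
  rewrite mulrC -ler_pdivlMr//; apply: le_trans e1; exact: expR_ge1Dx.
have SS : S (r + m%:R) <= 2 * S r.
  have := S0 (r + m%:R); nra.
have -> : e * r `^ (- sigma) * S r = (e / 2 * r `^ (- sigma)) * (2 * S r) by field.
apply: (@le_trans _ _ (D * S (r + m%:R))); first by lra.
have De : D <= e / 2 * r `^ (- sigma).
  by rewrite ler_wpM2r ?powR_ge0// ge_min lexx.
by apply: ler_pM => //; rewrite ?(ltW (S0 _))// mulr_ge0 ?powR_ge0// ltW.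
Unshelve. all: by end_near. Qed.

End Growth.
(** * Growth of polynomials *)

Section PolyGrowth.
Context {R : realType}.
Implicit Types (p q : {poly R}) (a b r : R).

(** The extra factor r avoids the exponent n - 1, so that n = 0, that is p = 0, is included. *)
Lemma poly_upper p n : (size p <= n)%N ->
  exists2 A, 0 <= A & forall r, 1 <= r -> r * `|p.[r]| <= A * r ^+ n.
Proof.
move=> pn; exists (\sum_(i < size p) `|p`_i|); first by rewrite sumr_ge0.
move=> r r1; have r0 : 0 <= r by rewrite (le_trans _ r1).
rewrite horner_coef mulr_suml -[X in X * _](ger0_norm r0) -normrM mulr_sumr.
apply: (le_trans (ler_norm_sum _ _ _)); apply: ler_sum => i _.
rewrite mulrCA normrM -exprS ler_wpM2l// ger0_norm ?exprn_ge0//.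
by rewrite ler_weXn2l// (leq_trans _ pn).
Qed.

Lemma poly_lower q : q != 0 -> exists2 c, 0 < c &
  \forall r \near +oo, c * r ^+ (size q).-1 <= `|q.[r]|.
Proof.
move=> q0; set d := (size q).-1.
have sq : size q = d.+1 by rewrite prednK// size_poly_gt0.
have [B B0 HB] := poly_upper (size_poly d (fun i => q`_i)).
have lc : 0 < `|lead_coef q| by rewrite normr_gt0 lead_coef_eq0.
exists (`|lead_coef q| / 2); first by rewrite divr_gt0.
near=> r.
have r1 : 1 <= r by near: r; apply: nbhs_pinfty_ge; exact: num_real.
have rB : B / (`|lead_coef q| / 2) <= r by near: r; apply: nbhs_pinfty_ge; exact: num_real.
have r0 : 0 < r by exact: lt_le_trans r1.
have -> : q.[r] = (\poly_(i < d) q`_i).[r] + lead_coef q * r ^+ d.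
  by rewrite horner_coef sq big_ord_recr horner_poly lead_coefE.
move: (HB _ r1); set u := _.[r] => Bu.
have rd0 : 0 < r ^+ d by rewrite exprn_gt0.
have u2 : `|u| <= `|lead_coef q| / 2 * r ^+ d.
  rewrite -(ler_pM2l r0) (le_trans Bu)// mulrA ler_pM2r//.
  by rewrite -ler_pdivrMr// divr_gt0.
have := ler_normD (lead_coef q * r ^+ d + u) (- u).
rewrite addrK normrN normrM (ger0_norm (ltW rd0)) [u + _]addrC; lra.
Unshelve. all: by end_near. Qed.

(** Both translates have the leading coefficient of p, which cancels in the difference. *)
Lemma poly_shift_size p a b :
  (size ((p \Po ('X + a%:P)) - (p \Po ('X + b%:P)))%R <= (size p).-1)%N.
Proof.
have sX c : size ('X + c%:P : {poly R}) = 2%N by rewrite size_XaddC.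
have lX c : lead_coef ('X + c%:P : {poly R}) = 1 by rewrite lead_coefXaddC.
have sc c : size (p \Po ('X + c%:P)) = size p by rewrite size_comp_poly2.
have cc c : (p \Po ('X + c%:P))`_(size p).-1 = lead_coef p.
  have := lead_coef_comp p (_ : (1 < size ('X + c%:P : {poly R})%R)%N).
  by rewrite sX lX expr1n mulr1 => <-//; rewrite lead_coefE sc.
apply/leq_sizeP => i; rewrite leq_eqVlt => /predU1P[<-|pi].
  by rewrite coefB !cc subrr.
by rewrite coefB !nth_default ?subrr// sc; case: (size p) pi.
Qed.

Lemma poly_increment p a b : exists2 C, 0 <= C &
  \forall r \near +oo, r * `|p.[r + a] - p.[r + b]| <= C * `|p.[r]|.
Proof.
have [->|p0] := eqVneq p 0.
  by exists 0 => //; near=> r; rewrite !horner0 subrr normr0 !mulr0.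
have [A A0 HA] := poly_upper (poly_shift_size p a b).
have [c c0 Hc] := poly_lower p0.
exists (A / c); first by rewrite divr_ge0// ltW.
near=> r.
have r1 : 1 <= r by near: r; apply: nbhs_pinfty_ge; exact: num_real.
have cr : c * r ^+ (size p).-1 <= `|p.[r]| by near: r.
have := HA _ r1; rewrite hornerD hornerN !horner_comp !hornerE => H.
apply: (le_trans H); rewrite -mulrA ler_wpM2l// mulrC ler_pdivlMr//.
by rewrite mulrC.
Unshelve. all: by end_near. Qed.

Lemma poly_linear_lower p : (1 < size p)%N -> exists2 c, 0 < c &
  \forall r \near +oo, c * r <= `|p.[r]|.
Proof.
move=> p1; have p0 : p != 0 by rewrite -size_poly_gt0 (ltn_trans _ p1).
have [c c0 Hc] := poly_lower p0; exists c => //; near=> r.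
have r1 : 1 <= r by near: r; apply: nbhs_pinfty_ge; exact: num_real.
have cr : c * r ^+ (size p).-1 <= `|p.[r]| by near: r.
apply: le_trans cr; rewrite ler_pM2l// -[leLHS]expr1 ler_weXn2l//.
by rewrite -ltnS prednK// (ltn_trans _ p1).
Unshelve. all: by end_near. Qed.

End PolyGrowth.

(** * Monotonicity of the root sums of entire functions *)

Section RootSumOrder.
Context {R : realType}.
Variables (n : nat) (f : R -> R).
Hypothesis fe : entire n f.
Implicit Types (x y r : R) (P : set R).

Local Notation rs := (root_sum n f).

Lemma root_sum_ge0 P x : 0 <= rs P x.
Proof.
rewrite /root_sum big_nat; apply: sumr_ge0 => j /andP[j1 _].
by apply: fsumr_ge0 => z _; rewrite mulr_ge0 ?kern_ge0 ?fe.2.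
Qed.

Lemma root_sum_le P x y : x <= y -> rs P x <= rs P y.
Proof.
move=> xy; have [s us sP] := omega_support y fe.1.
rewrite !(root_sumE _ _ sP us)// big_nat [leRHS]big_nat.
apply: ler_sum => j /andP[j1 _]; apply: ler_sum => z _.
by rewrite ler_wpM2l ?fe.2// le_kern// lerD2r.
Qed.

(** With nonnegative [omega] every kernel has nonnegative increments, so more roots and a longer
    interval can only increase the total. *)
Lemma root_sum_increment P x y x0 y0 : x0 <= x -> x <= y -> y <= y0 ->
  rs P y - rs P x <= rs setT y0 - rs setT x0.
Proof.
move=> x0x xy yy0; have [s us sP] := omega_support y0 fe.1.
have x0y0 := le_trans x0x (le_trans xy yy0).
rewrite !(root_sumE _ _ sP us) ?(le_trans xy)// -!sumrB big_nat [leRHS]big_nat.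
apply: ler_sum => j /andP[j1 _]; rewrite -!sumrB big_mkcond [leRHS]big_mkcond.
apply: ler_sum => z _; rewrite in_setT -!mulrBr; have w0 := fe.2 j z j1.
have k0 : kern j x0 z <= kern j x z by rewrite le_kern// lerD2r.
have k1 : kern j x z <= kern j y z by rewrite le_kern// lerD2r.
have k2 : kern j y z <= kern j y0 z by rewrite le_kern// lerD2r.
by case: ifP => _; [rewrite ler_wpM2l//|rewrite mulr_ge0//]; lra.
Qed.

Lemma root_sum_norm_increment P x y x0 y0 : x0 <= x <= y0 -> x0 <= y <= y0 ->
  `|rs P x - rs P y| <= rs setT y0 - rs setT x0.
Proof.
move=> /andP[x0x xy0] /andP[x0y yy0]; have [xy|yx] := leP x y.
  by rewrite distrC ger0_norm ?root_sum_increment// subr_ge0 root_sum_le.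
by rewrite ger0_norm ?root_sum_increment ?subr_ge0 ?root_sum_le// ltW.
Qed.

Lemma root_sum_sub P x : rs P x <= rs setT x.
Proof.
have [s us sP] := omega_support x fe.1.
rewrite !(root_sumE _ _ sP us)// big_nat [leRHS]big_nat.
apply: ler_sum => j /andP[j1 _]; rewrite big_mkcond [leRHS]big_mkcond.
apply: ler_sum => z _; rewrite in_setT; case: ifP => // _.
by rewrite mulr_ge0 ?kern_ge0 ?fe.2.
Qed.

Lemma root_sum_star P x y : 0 <= x <= y -> rs P x * y <= rs P y * x.
Proof.
move=> /andP[x0 xy]; have [s us sP] := omega_support y fe.1.
rewrite !(root_sumE _ _ sP us)// !mulr_suml big_nat [leRHS]big_nat.
apply: ler_sum => j /andP[j1 _]; rewrite !mulr_suml; apply: ler_sum => z _.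
rewrite -[leLHS]mulrA -[leRHS]mulrA; apply: ler_wpM2l; first exact: fe.2.
by apply: kern_star; rewrite ?x0.
Qed.

End RootSumOrder.
(** * Tropical curves and their Casoratian *)

Section Curve.
Context {R : realType}.
Variables (n m : nat) (ff : 'I_m.+1 -> R -> R).
Hypothesis fe : forall i, entire n (ff i).
Implicit Types (x y r : R) (i a b : 'I_m.+1).

Let fn i : locally_poly n (ff i) := (fe i).1.

Definition root_total r : R := \sum_(i < m.+1) root_sum n (ff i) setT r.

Lemma root_total_le x y : x <= y -> root_total x <= root_total y.
Proof. by move=> xy; apply: ler_sum => i _; exact: root_sum_le. Qed.

Lemma root_total_ge0 x : 0 <= root_total x.
Proof. by apply: sumr_ge0 => i _; exact: root_sum_ge0. Qed.

Lemma root_sum_total i x : root_sum n (ff i) setT x <= root_total x.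
Proof.
rewrite /root_total (bigD1 i)//= lerDl; apply: sumr_ge0 => k _.
exact: root_sum_ge0.
Qed.

Lemma root_sum_total_increment i x y : x <= y ->
  root_sum n (ff i) setT y - root_sum n (ff i) setT x <= root_total y - root_total x.
Proof.
move=> xy; rewrite /root_total -[leRHS]sumrB [leRHS](bigD1 i)//= lerDl.
by apply: sumr_ge0 => k _; rewrite subr_ge0 root_sum_le.
Qed.

Definition casoratian_defect x : R :=
  casoratian ff x - \sum_(i < m.+1) trop_shift i (ff i) x.

Lemma sum_even_index (G : nat -> R) k :
  \sum_(1 <= j < k.+1) (if odd j then 0 else G j) =
  \sum_(1 <= j < (k./2).+1) G (2 * j)%N.
Proof.
elim: k => [|k IHk]; first by rewrite !big_geq.
rewrite big_nat_recr//= IHk uphalf_half; case: ifP => [|/negbFE] ok.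
  by rewrite (negbTE ok) add0n addr0.
rewrite ok add1n [RHS]big_nat_recr//=; congr (_ + G _).
by rewrite mulnS mul2n -{1}(odd_double_half k) ok add1n !addSn.
Qed.

Lemma Ncount_shift_total i r :
  \sum_(1 <= j < n.+1)
    `|Ncount j r (trop_div (@trop_one R) (trop_shift i (ff i))) -
      Ncount j r (trop_div (@trop_one R) (ff i))| <=
  \sum_(1 <= j < (n./2).+1)
    `|Ncount_on (2 * j)%N (- (2 * i)%N%:R) 0 r
        (trop_div (@trop_one R) (trop_shift i (ff i)))
      - Ncount_on (2 * j)%N (- i%:R) i%:R r (trop_div (@trop_one R) (ff i))| +
  (root_sum n (ff i) setT (r + m%:R) - root_sum n (ff i) setT (r - m%:R)).
Proof.
pose G j := `|Ncount_on j (- (2 * i)%N%:R) 0 r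
        (trop_div (@trop_one R) (trop_shift i (ff i)))
      - Ncount_on j (- i%:R) i%:R r (trop_div (@trop_one R) (ff i))|.
rewrite -(sum_even_index G).
have NE x : \sum_(1 <= j < n.+1) Ncount j x (trop_div (@trop_one R) (ff i)) =
    2^-1 * root_sum n (ff i) setT x.
  rewrite /root_sum mulr_sumr; apply: eq_big_nat => j /andP[j1 _].
  by rewrite (Ncount_entire _ (fe i)).
have im : i%:R <= m%:R :> R by rewrite ler_nat -ltnS.
have Hr : root_sum n (ff i) setT (r + i%:R) <= root_sum n (ff i) setT (r + m%:R).
  by rewrite root_sum_le// lerD2l.
have Hl : root_sum n (ff i) setT (r - m%:R) <= root_sum n (ff i) setT (r - i%:R).
  by rewrite root_sum_le// lerD2l lerN2.
have Hm : root_sum n (ff i) setT (r - i%:R) <= root_sum n (ff i) setT (r + i%:R).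
  by rewrite root_sum_le// lerD2l (@le_trans _ _ 0) ?oppr_le0.
apply: (@le_trans _ _ (\sum_(1 <= j < n.+1) ((if odd j then 0 else G j) +
   (Ncount j (r + i%:R) (trop_div (@trop_one R) (ff i)) -
    Ncount j (r - i%:R) (trop_div (@trop_one R) (ff i)))))).
  rewrite big_nat [leRHS]big_nat; apply: ler_sum => j /andP[j1 _].
  case: ifP => oj; first by rewrite add0r (Ncount_shift_odd _ _ (fe i)).
  exact: (Ncount_shift_even _ _ (fe i)).
rewrite big_split sumrB /= !NE lerD2l; lra.
Qed.

(** The counting functions [LC] of the shifted coordinates are inserted: [LC - LA] is the effect of
    the shifts, and [LC - LB] is evaluated by the Jensen formula. *)
Lemma counting_difference_le r : 0 < r ->
  `|\sum_(i < m.+1) \sum_(1 <= j < n.+1)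
       Ncount j r (trop_div (@trop_one R) (ff i))
    - \sum_(1 <= j < n.+1) Ncount j r (trop_div (@trop_one R) (casoratian ff))|
  <= \sum_(1 <= j < n.+1)
       `|Ncount j r (casoratian ff)
         - \sum_(i < m.+1) Ncount j r (trop_shift i (ff i))|
     + \sum_(i < m.+1) \sum_(1 <= j < (n./2).+1)
       `|Ncount_on (2 * j)%N (- (2 * i)%N%:R) 0 r
           (trop_div (@trop_one R) (trop_shift i (ff i)))
         - Ncount_on (2 * j)%N (- i%:R) i%:R r (trop_div (@trop_one R) (ff i))|
     + (root_total (r + m%:R) - root_total (r - m%:R)
        + (`|casoratian_defect r| + `|casoratian_defect (- r)|
           + 2 * `|casoratian_defect 0|)).
Proof.
move=> r0; have Cn : locally_poly n (casoratian ff) by exact: locally_poly_casoratian.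
have sn i : locally_poly n (trop_shift i (ff i)) by exact: locally_poly_shift.
set LA := \sum_(i < m.+1) _; set LB := \sum_(1 <= j < n.+1) _.
pose LC := \sum_(i < m.+1) \sum_(1 <= j < n.+1)
  Ncount j r (trop_div (@trop_one R) (trop_shift i (ff i))).
set R1 := \sum_(1 <= j < n.+1) _; set R2 := \sum_(i < m.+1) _.
have HAC : `|LC - LA| <= R2 + (root_total (r + m%:R) - root_total (r - m%:R)).
  rewrite /LC /LA /R2 /root_total -sumrB -[X in _ + X]sumrB -big_split/=.
  apply: (le_trans (ler_norm_sum _ _ _)); apply: ler_sum => i _.
  by rewrite -sumrB (le_trans (ler_norm_sum _ _ _))// Ncount_shift_total.
(* The Jensen formula is linear in the values at r, -r and 0, so those of the Casoratian and of the
   shifts combine into the defect. *)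
have HCB : LC - LB = - \sum_(1 <= j < n.+1) (Ncount j r (casoratian ff)
         - \sum_(i < m.+1) Ncount j r (trop_shift i (ff i)))
   - 2^-1 * (casoratian_defect r + casoratian_defect (- r) - 2 * casoratian_defect 0).
  rewrite /LC /LB (Ncount_jensen _ Cn) -(jensen Cn r0).
  under eq_bigr => i _ do rewrite (Ncount_jensen _ (sn i)) -(jensen (sn i) r0).
  rewrite big_split/= -mulr_sumr exchange_big/= sumrB big_split/= sumrB.
  by rewrite -mulr_sumr /casoratian_defect; lra.
have HCB' : `|LC - LB| <= R1 + (`|casoratian_defect r| + `|casoratian_defect (- r)|
           + 2 * `|casoratian_defect 0|).
  rewrite HCB (le_trans (ler_normB _ _))// lerD//.
    by rewrite normrN ler_norm_sum.
  rewrite normrM ger0_norm ?invr_ge0// (le_trans (ler_wpM2l _ (ler_normB _ _)))//.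
  have := ler_normD (casoratian_defect r) (casoratian_defect (- r)).
  have := normr_ge0 (casoratian_defect r); have := normr_ge0 (casoratian_defect (- r)).
  have := normr_ge0 (casoratian_defect 0).
  by rewrite normrM ger0_norm//; lra.
have := ler_normB (LC - LB) (LC - LA).
have -> : LC - LB - (LC - LA) = LA - LB by ring.
by lra.
Qed.

Definition coord_difference i x : R := ff i x - ff ord0 x.

Local Notation g := coord_difference.

(** Permuting the shifts of [ff ord0] does not change their sum, so [ff ord0] can be subtracted from
    every coordinate. Each candidate in the maximum then exceeds the identity term by a sum of m + 1
    increments of [g]. *)
Lemma casoratian_defect_le x (B : R) :
  (forall i a b, `|g i (x + a%:R) - g i (x + b%:R)| <= B) ->
  `|casoratian_defect x| <= m.+1%:R * B.
Proof.
move=> gB; have B0 : 0 <= B by rewrite (le_trans (normr_ge0 _) (gB ord0 ord0 ord0)).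
rewrite ger0_norm; last by rewrite subr_ge0 bigmax_ge_id.
rewrite lerBlDr; apply: bigmax_le => [|s _]; first by rewrite lerDr mulr_ge0.
rewrite -lerBlDr.
have f0s : \sum_(i < m.+1) trop_shift (s i) (ff ord0) x =
    \sum_(i < m.+1) trop_shift i (ff ord0) x.
  by rewrite [RHS](reindex_inj (@perm_inj _ s)).
have -> : \sum_(i < m.+1) trop_shift (s i) (ff i) x -
    \sum_(i < m.+1) trop_shift i (ff i) x =
    \sum_(i < m.+1) (g i (x + (s i)%:R) - g i (x + i%:R)).
  rewrite sumrB /coord_difference !sumrB /trop_shift in f0s *; rewrite f0s; ring.
apply: (@le_trans _ _ (\sum_(i < m.+1) B)).
  by apply: ler_sum => i _; rewrite (le_trans (ler_norm _)).
by rewrite sumr_const card_ord mulr_natl.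
Qed.

Lemma norm_difference_le (A A' p p' q q' u v w u' v' : R) :
  `|p - p'| <= u - v -> `|q - q'| <= u' - v' -> u - v <= w -> u' - v' <= w ->
  `|A + (p - q) - (A' + (p' - q'))| <= `|A - A'| + 2 * w.
Proof.
move=> pp qq uw uw'.
have -> : A + (p - q) - (A' + (p' - q')) = (A - A') + ((p - p') - (q - q')) by ring.
rewrite (le_trans (ler_normD _ _))// lerD2l (le_trans (ler_normB _ _))//; lra.
Qed.

Definition rpoly i : {poly R} := rgerm (ff i) 0 - rgerm (ff ord0) 0.
(** Composition with -X lets both sides of 0 be studied at large positive arguments. *)
Definition lpoly i : {poly R} := (lgerm (ff i) 0 - lgerm (ff ord0) 0) \Po (- 'X).

Lemma right_differenceE i x : 0 < x -> g i x = (rpoly i).[x] +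
  (root_sum n (ff i) [set z | 0 < z] x - root_sum n (ff ord0) [set z | 0 < z] x).
Proof.
move=> x0; rewrite /coord_difference (right_rep (fn i) x0) (right_rep (fn ord0) x0).
by rewrite hornerD hornerN; ring.
Qed.

Lemma left_differenceE i x : 0 < x -> g i (- x) = (lpoly i).[x] +
  (root_sum n (ff i) [set z | z < 0] x - root_sum n (ff ord0) [set z | z < 0] x).
Proof.
move=> x0; rewrite /coord_difference (left_rep (fn i) x0) (left_rep (fn ord0) x0).
by rewrite /lpoly horner_comp hornerN hornerX hornerD hornerN; ring.
Qed.

Lemma right_difference_le i a b r : m%:R < r ->
  `|g i (r + a%:R) - g i (r + b%:R)| <=
  `|(rpoly i).[r + a%:R] - (rpoly i).[r + b%:R]| +
  2 * (root_total (r + m%:R) - root_total (r - m%:R)).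
Proof.
move=> mr; have r0 : 0 < r by rewrite (le_lt_trans _ mr).
have cm (c : 'I_m.+1) : c%:R <= m%:R :> R by rewrite ler_nat -ltnS.
have c0 (c : 'I_m.+1) : 0 <= c%:R :> R by [].
have rc (c : 'I_m.+1) : r - m%:R <= r + c%:R <= r + m%:R.
  by have := cm c; have := c0 c; move=> *; apply/andP; split; lra.
have rc0 (c : 'I_m.+1) : 0 < r + c%:R by rewrite ltr_wpDr.
rewrite !right_differenceE//.
have rr : r - m%:R <= r + m%:R by have /andP[/le_trans H /H] := rc a.
have H1 := root_sum_norm_increment (fe i) [set z | 0 < z] (rc a) (rc b).
have H2 := root_sum_norm_increment (fe ord0) [set z | 0 < z] (rc a) (rc b).
have H3 := root_sum_total_increment i rr.
have H4 := root_sum_total_increment ord0 rr.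
exact: norm_difference_le H1 H2 H3 H4.
Qed.

Lemma left_difference_le i a b r : m%:R < r ->
  `|g i (- r + a%:R) - g i (- r + b%:R)| <=
  `|(lpoly i).[r - a%:R] - (lpoly i).[r - b%:R]| +
  2 * (root_total (r + m%:R) - root_total (r - m%:R)).
Proof.
move=> mr; have r0 : 0 < r by rewrite (le_lt_trans _ mr).
have cm (c : 'I_m.+1) : c%:R <= m%:R :> R by rewrite ler_nat -ltnS.
have c0 (c : 'I_m.+1) : 0 <= c%:R :> R by [].
have rc (c : 'I_m.+1) : r - m%:R <= r - c%:R <= r + m%:R.
  by have := cm c; have := c0 c; move=> *; apply/andP; split; lra.
have rc0 (c : 'I_m.+1) : 0 < r - c%:R by rewrite subr_gt0 (le_lt_trans (cm c)).
have NE (c : 'I_m.+1) : - r + c%:R = - (r - c%:R) by rewrite opprB addrC.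
rewrite !NE !left_differenceE//.
have rr : r - m%:R <= r + m%:R by have /andP[/le_trans H /H] := rc a.
have H1 := root_sum_norm_increment (fe i) [set z | z < 0] (rc a) (rc b).
have H2 := root_sum_norm_increment (fe ord0) [set z | z < 0] (rc a) (rc b).
have H3 := root_sum_total_increment i rr.
have H4 := root_sum_total_increment ord0 rr.
exact: norm_difference_le H1 H2 H3 H4.
Qed.

Lemma trop_max_ge i x : ff i x <= trop_max ff x.
Proof. exact: le_bigmax. Qed.

Lemma trop_max_normB i x : ff i x + ff ord0 x + `|g i x| <= 2 * trop_max ff x.
Proof.
have := trop_max_ge i x; have := trop_max_ge ord0 x; rewrite /coord_difference.
by case: (lerP 0 (ff i x - ff ord0 x)) => [/ger0_norm->|/ltr0_norm->]; lra.
Qed.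

(** As F >= f_i, the Jensen formula bounds each root sum by T. As f_i + f_0 + |f_i - f_0| <= 2 F,
    the differences are bounded too, and removing their kernels leaves the polynomial parts. K
    absorbs the values at 0. *)
Lemma Tchar_lower : exists A K : R, [/\ 0 <= A, 0 <= K & forall r, 0 < r ->
  [/\ 0 <= Tchar ff r + K, root_total r <= A * (Tchar ff r + K) &
   forall i, `|(rpoly i).[r]| <= A * (Tchar ff r + K) /\
             `|(lpoly i).[r]| <= A * (Tchar ff r + K)]].
Proof.
pose K := 2 * (`|trop_max ff 0| + \sum_(i < m.+1) `|ff i 0|).
have s0 : 0 <= \sum_(i < m.+1) `|ff i 0| by rewrite sumr_ge0.
have K0 : 0 <= K by rewrite mulr_ge0// addr_ge0.
have Ki i : 2 * (trop_max ff 0 - ff i 0) <= K.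
  rewrite /K ler_pM2l// lerD ?ler_norm// (bigD1 i)//= -[- ff i 0]addr0 lerD//.
    by rewrite (le_trans (ler_norm _))// normrN.
  by rewrite sumr_ge0.
(* The summand 8 serves the polynomial parts, 2 (m + 1) the sum of the m + 1 root sums. *)
exists (8 + 2 * m.+1%:R), K; split => // r r0.
set T := Tchar ff r.
have J i : ff i r + ff i (- r) - 2 * ff i 0 = root_sum n (ff i) setT r.
  exact: jensen (fn i) r0.
have TE : trop_max ff r + trop_max ff (- r) = 2 * (T + trop_max ff 0).
  by rewrite /T /Tchar; field.
have Hr i : root_sum n (ff i) setT r <= 2 * (T + K).
  have := trop_max_ge i r; have := trop_max_ge i (- r); have := Ki i; have := J i.
  by move=> *; lra.
have TK : 0 <= T + K.
  by have := Hr ord0; have := root_sum_ge0 (fe ord0) setT r; move=> *; lra.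
have Hg i : `|g i r| + `|g i (- r)| <= 4 * (T + K).
  have := trop_max_normB i r; have := trop_max_normB i (- r).
  have := Ki i; have := Ki ord0; have := J i; have := J ord0.
  have := root_sum_ge0 (fe ord0) setT r; have := root_sum_ge0 (fe i) setT r.
  by move=> *; lra.
have m1 : (0 : R) <= m.+1%:R by [].
have mTK : 0 <= m.+1%:R * (T + K) by rewrite mulr_ge0.
have Hp i (P : set R) (p gx : R) :
    gx = p + (root_sum n (ff i) P r - root_sum n (ff ord0) P r) ->
    `|gx| <= 4 * (T + K) -> `|p| <= 8 * (T + K).
  move=> gE; have := root_sum_sub (fe i) P r; have := root_sum_sub (fe ord0) P r.
  have := root_sum_ge0 (fe i) P r; have := root_sum_ge0 (fe ord0) P r.
  have := Hr i; have := Hr ord0; rewrite !ler_norml => ? ? ? ? ? ? /andP[? ?].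
  by apply/andP; split; lra.
split => // [|i].
  apply: (@le_trans _ _ (\sum_(i < m.+1) (2 * (T + K)))).
    by apply: ler_sum => i _; exact: Hr.
  by rewrite sumr_const card_ord -mulr_natl; lra.
have := Hg i; have := normr_ge0 (g i r); have := normr_ge0 (g i (- r)).
move=> g1 g2 g12; split.
  apply: le_trans (Hp _ _ _ _ (right_differenceE i r0) _) _; lra.
apply: le_trans (Hp _ _ _ _ (left_differenceE i r0) _) _; lra.
Qed.

End Curve.
(** * Negligible terms *)

Section Asymptotics.
Context {R : realType}.
Variables (n m : nat) (ff : 'I_m.+1 -> R -> R).
Hypothesis fe : forall i, entire n (ff i).
Implicit Types (x y r e : R) (i a b : 'I_m.+1).

Local Notation T := (Tchar ff).
Local Notation S := (root_total n ff).

(** Without kernels and with constant polynomial parts, every f_i - f_0 is constant, so all its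
    increments vanish. *)
Lemma casoratian_defect_eq0 : (forall r, S r = 0) ->
  (forall i, (size (rpoly ff i) <= 1)%N /\ (size (lpoly ff i) <= 1)%N) ->
  forall x, casoratian_defect ff x = 0.
Proof.
move=> S0 sz x.
have rs0 i (P : set R) r : root_sum n (ff i) P r = 0.
  apply/le_anti/andP; split; last exact: root_sum_ge0.
  by rewrite (le_trans (root_sum_sub (fe i) P r))// -(S0 r) root_sum_total.
have gE i y : coord_difference ff i y = coord_difference ff i 0.
  have [sr sl] := sz i.
  have [y0|y0|->//] := ltgtP y 0.
    rewrite -[y]opprK (left_differenceE fe) ?oppr_gt0// !rs0 subr0 addr0.
    rewrite (size1_polyC sl) hornerC -(hornerC (lpoly ff i)`_0 0) -size1_polyC//.
    rewrite horner_comp hornerN hornerX oppr0 hornerD hornerN.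
    by rewrite !(horner_lgerm 0 (fe _).1).
  rewrite (right_differenceE fe)// !rs0 subr0 addr0.
  rewrite (size1_polyC sr) hornerC -(hornerC (rpoly ff i)`_0 0) -size1_polyC//.
  by rewrite hornerD hornerN !(horner_rgerm 0 (fe _).1).
apply/eqP; rewrite -normr_eq0 eq_le normr_ge0 andbT -[leRHS](mulr0 m.+1%:R).
by apply: casoratian_defect_le => i a b; rewrite !gE subrr normr0.
Qed.

(** Everything bounded in [Tchar_lower] would force linear growth of T if it grew linearly. A
    nonzero S does so by [root_sum_star], and a nonconstant polynomial by [poly_linear_lower];
    otherwise [casoratian_defect_eq0] applies. *)
Lemma Tchar_dichotomy :
  (exists2 c, 0 < c & \forall r \near +oo, c * r <= T r) \/
  (forall r, S r = 0) /\ (forall x, casoratian_defect ff x = 0).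
Proof.
have [A [K [A0 K0 HT]]] := Tchar_lower fe.
case: (pselect (exists2 c, 0 < c & \forall r \near +oo, c * r <= T r)) => [|nG].
  by left.
right.
have gen (h : R -> R) c : 0 < c -> (\forall r \near +oo, c * r <= h r) ->
    ~ (forall r, 0 < r -> h r <= A * (T r + K)).
  move=> c0 ch hT; apply: nG; have A1 : 0 < A + 1 by rewrite ltr_wpDl.
  exists (c / (2 * (A + 1))); first by rewrite divr_gt0// mulr_gt0.
  near=> r.
  have r0 : 0 < r by near: r; exact: nbhs_pinfty_gt.
  have rK : 2 * (A + 1) * K / c <= r by near: r; apply: nbhs_pinfty_ge; exact: num_real.
  have cr : c * r <= h r by near: r.
  have [TK _ _] := HT _ r0; have := hT r r0.
  move: rK; rewrite ler_pdivrMr// => rK hr.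
  rewrite mulrAC ler_pdivrMr ?mulr_gt0//; nra.
have S0 r : S r = 0.
  apply/le_anti/andP; split; last exact: root_total_ge0.
  rewrite leNgt; apply/negP => Sr0; pose t := Num.max r 1.
  have t1 : 1 <= t by rewrite le_max lexx orbT.
  have t0 : 0 < t by exact: lt_le_trans t1.
  have St0 : 0 < S t by rewrite (lt_le_trans Sr0)// root_total_le// le_max lexx.
  apply: (gen S (S t / t)); first by rewrite divr_gt0.
    near=> y.
    have ty : t <= y by near: y; apply: nbhs_pinfty_ge; exact: num_real.
    rewrite mulrAC ler_pdivrMr// /root_total !mulr_suml; apply: ler_sum => i _.
    by apply: root_sum_star => //; rewrite ty ltW.
  by move=> y /HT[].
split => //; apply: casoratian_defect_eq0 => // i; split; rewrite leqNgt; apply/negP.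
  move=> /poly_linear_lower[c c0 /(gen _ _ c0)]; apply => y y0.
  by have [_ _ /(_ i)[]] := HT y y0.
move=> /poly_linear_lower[c c0 /(gen _ _ c0)]; apply => y y0.
by have [_ _ /(_ i)[]] := HT y y0.
Unshelve. all: by end_near. Qed.

Lemma hyper_order_near (h : R -> R) (rho : R) : (hyper_order h < rho%:E)%E ->
  \forall r \near +oo, ln (ln (h r)) / ln r < rho.
Proof.
rewrite /hyper_order limf_esupE => /ereal_inf_lt[_ [A Aoo <-] hA].
apply: filterS Aoo => r Ar; rewrite -lte_fin; apply: le_lt_trans hA.
by apply: ereal_sup_ubound; exists r.
Qed.

Variables (sigma c : R).
Hypotheses (sigma1 : sigma < 1) (c0 : 0 < c).
Hypothesis Tc : \forall r \near +oo, c * r <= T r.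

Lemma Tchar_large (M : R) : \forall r \near +oo, M <= T r.
Proof.
near=> r; have cr : c * r <= T r by near: r.
have Mr : M / c <= r by near: r; apply: nbhs_pinfty_ge; exact: num_real.
by apply: le_trans cr; rewrite mulrC -ler_pdivrMr.
Unshelve. all: by end_near. Qed.

(** T(r) r^(-sigma) is at least c r^(1 - sigma), which is unbounded as sigma < 1. *)
Lemma cst_small (M e : R) : 0 < e ->
  \forall r \near +oo, M <= e * (T r * r `^ (- sigma)).
Proof.
move=> e0; have M0 : 0 < `|M| + 1 by rewrite ltr_wpDl.
near=> r.
have r0 : 0 < r by near: r; exact: nbhs_pinfty_gt.
have cr : c * r <= T r by near: r.
have rs : r `^ (- (1 - sigma)) <= e * c / (`|M| + 1).
  by near: r; apply: powR_small; rewrite ?subr_gt0// divr_gt0// mulr_gt0.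
apply: (@le_trans _ _ (e * (c * r * r `^ (- sigma)))); last first.
  by rewrite ler_pM2l// ler_wpM2r// powR_ge0.
have -> : e * (c * r * r `^ (- sigma)) = e * c * r `^ (1 - sigma).
  rewrite powRD ?(gt_eqF r0) ?implybT// powRr1 ?(ltW r0)//; ring.
have r1s : 0 < r `^ (1 - sigma) by exact: powR_gt0.
move: rs; rewrite powRN ler_pdivlMr// mulrC ler_pdivrMr// => H.
by have := ler_norm M; lra.
Unshelve. all: by end_near. Qed.

(** The increment is O(|p(r)| / r) = O(T(r) / r), and 1/r = o(r^(-sigma)). *)
Lemma poly_small (p : {poly R}) (A K a b e : R) : 0 < e ->
  (forall r, 0 < r -> `|p.[r]| <= A * (T r + K)) ->
  \forall r \near +oo, `|p.[r + a] - p.[r + b]| <= e * (T r * r `^ (- sigma)).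
Proof.
move=> e0 pT; have [C C0 HC] := poly_increment p a b.
have M0 : 0 < 2 * (C * `|A|) + 1 by rewrite ltr_wpDl// !mulr_ge0.
near=> r.
have r0 : 0 < r by near: r; exact: nbhs_pinfty_gt.
have Cr : r * `|p.[r + a] - p.[r + b]| <= C * `|p.[r]| by near: r.
have TK : `|K| <= T r by near: r; exact: Tchar_large.
have T0 : 0 <= T r by exact: le_trans TK.
have rs : r `^ (- (1 - sigma)) <= e / (2 * (C * `|A|) + 1).
  by near: r; apply: powR_small; rewrite ?subr_gt0// divr_gt0.
have pA : `|p.[r]| <= `|A| * (2 * T r).
  apply: (le_trans (pT _ r0)); apply: (@le_trans _ _ (`|A| * `|T r + K|)).
    by rewrite -normrM ler_norm.
  rewrite ler_wpM2l// (le_trans (ler_normD _ _))// (ger0_norm T0); lra.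
rewrite -(ler_pM2l r0) (le_trans Cr)// (le_trans (ler_wpM2l C0 pA))//.
have -> : r * (e * (T r * r `^ (- sigma))) = T r * (e * r `^ (1 - sigma)).
  rewrite powRD ?(gt_eqF r0) ?implybT// powRr1 ?(ltW r0)//; ring.
have r1s : 0 < r `^ (1 - sigma) by exact: powR_gt0.
move: rs; rewrite powRN ler_pdivlMr// mulrC ler_pdivrMr// => H.
have -> : C * (`|A| * (2 * T r)) = T r * (2 * (C * `|A|)) by ring.
by rewrite ler_wpM2l//; lra.
Unshelve. all: by end_near. Qed.

(** [expR_increment_small] is applied to S + e: the constant ensures the lower bound e and cancels
    in the increment. *)
Lemma root_total_small (sigma0 : 0 < sigma) (rho : R) :
  (hyper_order T < rho%:E)%E -> rho + sigma < 1 ->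
  exists2 E, finite_log_measure E & forall e, 0 < e ->
    \forall r \near +oo, ~ E r ->
      S (r + m%:R) - S (r - m%:R) <= e * (T r * r `^ (- sigma)).
Proof.
move=> /hyper_order_near hT rs; have [A [K [A0 K0 HT]]] := Tchar_lower fe.
(* For T >= 1 one has A (T + K) + e <= B T; moreover B >= e, so ln B >= 0. *)
pose B := A * (1 + K) + expR 1.
have e1 : (0 : R) < expR 1 by exact: expR_gt0.
have B0 : 0 < B by rewrite ltr_wpDl// mulr_ge0// addr_ge0.
have lnB : 0 <= ln B.
  rewrite ln_ge0// (@le_trans _ _ (expR 1))//.
    by rewrite (le_trans _ (expR_ge1Dx _))// lerDl.
  by rewrite lerDr mulr_ge0// addr_ge0.
have ST : \forall r \near +oo, S r + expR 1 <= B * T r.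
  near=> r.
  have r0 : 0 < r by near: r; exact: nbhs_pinfty_gt.
  have T1 : 1 <= T r by near: r; exact: Tchar_large.
  have [_ SA _] := HT _ r0; rewrite /B.
  have AK : 0 <= A * K by rewrite mulr_ge0.
  nra.
(* Once T >= e and r > 1 the quotient bounded by [rho] is nonnegative; this is where [rho >= 0]
   comes from. *)
have lnT : \forall r \near +oo, [/\ 1 < r, 0 <= rho & ln (T r) <= r `^ rho].
  near=> r.
  have r1 : 1 < r by near: r; apply: nbhs_pinfty_gt; exact: num_real.
  have r0 : 0 < r by exact: lt_trans r1.
  have Te : expR 1 <= T r by near: r; exact: Tchar_large.
  have T0 : 0 < T r by exact: lt_le_trans Te.
  have lr : 0 < ln r by exact: ln_gt0.
  have lT : 1 <= ln (T r) by rewrite -[leLHS](@expRK R) ler_ln ?posrE.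
  have llT : 0 <= ln (ln (T r)) by exact: ln_ge0.
  have : ln (ln (T r)) / ln r < rho by near: r.
  move=> H; split => //.
    by apply: ltW; apply: le_lt_trans H; rewrite divr_ge0// ltW.
  rewrite -(lnK (_ : ln (T r) \is Num.pos)) ?posrE ?(lt_le_trans ltr01 lT)//.
  rewrite /powR gt_eqF// ler_expR.
  by move: H; rewrite ltr_pdivrMr// => /ltW.
have rho0 : 0 <= rho.
  near (@pinfty_nbhs R) => r.
  by have [] : [/\ 1 < r, 0 <= rho & ln (T r) <= r `^ rho] by near: r.
have Smono : {homo (fun r => S r + expR 1) : x y / x <= y}.
  by move=> x y xy; rewrite lerD2r root_total_le.
have [||E mE HE] := expR_increment_small m Smono _ rho0 rs (ltW sigma0) (C := ln B + 1).
- by move=> x; rewrite lerDr root_total_ge0.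
- near=> r.
  have [r1 _ lTr] : [/\ 1 < r, 0 <= rho & ln (T r) <= r `^ rho] by near: r.
  have T1 : 1 <= T r by near: r; exact: Tchar_large.
  have T0 : 0 < T r by exact: lt_le_trans T1.
  have SB : S r + expR 1 <= B * T r by near: r.
  have S0 : 0 < S r + expR 1 by rewrite ltr_wpDl// root_total_ge0.
  apply: (@le_trans _ _ (ln (B * T r))).
    by rewrite ler_ln ?posrE// mulr_gt0.
  rewrite lnM ?posrE// mulrDl mul1r lerD// ler_peMr//.
  have r0 : 0 < r by exact: lt_trans r1.
  by rewrite -[leLHS](powRr0 r) ler_powR// ltW.
exists E => // e e0; have eB : 0 < e / B by rewrite divr_gt0.
near=> r => rE.
have H : ~ E r -> S (r + m%:R) + expR 1 - (S (r - m%:R) + expR 1) <=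
    e / B * r `^ (- sigma) * (S r + expR 1).
  by near: r; exact: (HE _ eB).
have := H rE; rewrite opprD addrACA subrr addr0 => {}H; apply: (le_trans H).
have SB : S r + expR 1 <= B * T r by near: r.
apply: (le_trans (ler_wpM2l _ SB)); first by rewrite mulr_ge0 ?powR_ge0// ltW.
have -> : e / B * r `^ (- sigma) * (B * T r) = e * (T r * r `^ (- sigma)).
  by field; rewrite gt_eqF.
by [].
Unshelve. all: by end_near. Qed.

Lemma error_small (E : set R) :
  (forall e, 0 < e -> \forall r \near +oo, ~ E r ->
     S (r + m%:R) - S (r - m%:R) <= e * (T r * r `^ (- sigma))) ->
  forall e, 0 < e -> \forall r \near +oo, ~ E r ->
    S (r + m%:R) - S (r - m%:R) +
    (`|casoratian_defect ff r| + `|casoratian_defect ff (- r)|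
     + 2 * `|casoratian_defect ff 0|) <= e * (T r * r `^ (- sigma)).
Proof.
move=> HE e e0; have [A [K [A0 K0 HT]]] := Tchar_lower fe.
have m1 : (0 : R) <= m.+1%:R by [].
(* One share each for the increment of S and for the defect at 0, and 3 (m + 1) shares for each
   defect at r and -r: per coordinate, one for the polynomial and two for the kernels. *)
pose d := e / (2 + 6 * m.+1%:R).
have d0 : 0 < d by rewrite divr_gt0// ltr_wpDr// mulr_ge0.
have right_small : \forall r \near +oo, forall i a b,
    `|(rpoly ff i).[r + a%:R] - (rpoly ff i).[r + b%:R]| <= d * (T r * r `^ (- sigma)).
  apply: filter_forall => i; apply: filter_forall => a; apply: filter_forall => b.
  by apply: (@poly_small _ A K) => // r /HT[_ _ /(_ i)[]].
have left_small : \forall r \near +oo, forall i a b,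
    `|(lpoly ff i).[r - a%:R] - (lpoly ff i).[r - b%:R]| <= d * (T r * r `^ (- sigma)).
  apply: filter_forall => i; apply: filter_forall => a; apply: filter_forall => b.
  by apply: (@poly_small _ A K) => // r /HT[_ _ /(_ i)[]].
near=> r => rE.
have mr : m%:R < r by near: r; apply: nbhs_pinfty_gt; exact: num_real.
have Sd : ~ E r -> S (r + m%:R) - S (r - m%:R) <= d * (T r * r `^ (- sigma)).
  by near: r; exact: (HE _ d0).
have D0 : 2 * `|casoratian_defect ff 0| <= d * (T r * r `^ (- sigma)).
  by near: r; exact: cst_small.
have {}Sd := Sd rE.
have Hr : forall i a b,
    `|(rpoly ff i).[r + a%:R] - (rpoly ff i).[r + b%:R]| <= d * (T r * r `^ (- sigma)).
  by near: r.
have Hl : forall i a b,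
    `|(lpoly ff i).[r - a%:R] - (lpoly ff i).[r - b%:R]| <= d * (T r * r `^ (- sigma)).
  by near: r.
set X := T r * r `^ (- sigma) in Sd D0 Hr Hl *.
have Dr : `|casoratian_defect ff r| <= m.+1%:R * (3 * (d * X)).
  apply: casoratian_defect_le => i a b; apply: (le_trans (right_difference_le fe i a b mr)).
  by have := Hr i a b; lra.
have Dl : `|casoratian_defect ff (- r)| <= m.+1%:R * (3 * (d * X)).
  apply: casoratian_defect_le => i a b; apply: (le_trans (left_difference_le fe i a b mr)).
  by have := Hl i a b; lra.
have -> : e * X = d * X + (m.+1%:R * (3 * (d * X)) + m.+1%:R * (3 * (d * X)) + d * X).
  by rewrite /d; field; rewrite gt_eqF// ltr_wpDr// mulr_ge0.
by rewrite lerD// lerD// lerD.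
Unshelve. all: by end_near. Qed.

End Asymptotics.

(** * Assembling the theorem *)

Lemma finite_log_measure0 (R : realType) : finite_log_measure (@set0 R).
Proof. by split => //; rewrite set0I integral_set0. Qed.

Lemma lte_sub_between (R : realType) (sigma : R) (h : \bar R) :
  (sigma%:E < 1%:E - h)%E -> exists2 rho : R, (h < rho%:E)%E & rho + sigma < 1.
Proof.
case: h => [h| |] //=; last by exists (- sigma); rewrite ?ltNyr// addNr.
rewrite -EFinB lte_fin => sh; exists ((h + 1 - sigma) / 2); rewrite ?lte_fin; lra.
Qed.

(** Serves to deduce sigma < 1 from sigma < 1 - rho_2 when T is large. *)
Lemma hyper_order_ge0 (R : realType) (h : R -> R) :
  (\forall r \near +oo, expR 1 <= h r) -> (0 <= hyper_order h)%E.
Proof.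
move=> hh; rewrite leNgt; apply/negP => /hyper_order_near hn.
near (@pinfty_nbhs R) => r.
have r1 : 1 < r by near: r; apply: nbhs_pinfty_gt; exact: num_real.
have he : expR 1 <= h r by near: r.
have : ln (ln (h r)) / ln r < 0 by near: r.
rewrite ltNge divr_ge0//.
  rewrite ln_ge0// -[leLHS](@expRK R) ler_ln ?posrE ?expR_gt0//.
  by rewrite (lt_le_trans _ he) ?expR_gt0.
by apply: ltW; exact: ln_gt0.
Unshelve. all: by end_near. Qed.

Theorem theorem6p2 (R : realType) (n m : nat) (hn : (1 <= n)%N) (hm : (1 <= m)%N)
    (f : R -> trop_proj R m) (ff : 'I_m.+1 -> R -> R)
    (hf : reduced_representation n f ff)
    (hwd : exists l : 'I_m.+1, forall i : 'I_m.+1,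
       well_defined (trop_div (ff i) (ff l)))
    (hrho : (hyper_order (Tchar ff) < 1%:E)%E)
    (sigma : R) (hsigma0 : 0 < sigma)
    (hsigma1 : (sigma%:E < 1%:E - hyper_order (Tchar ff))%E) :
  exists2 E : set R, finite_log_measure E &
  exists2 err : R -> R,
    forall eps : R, 0 < eps ->
      \forall r \near within (~` E) +oo%R,
        `|err r| <= eps * `|Tchar ff r / r `^ sigma| &
    \forall r \near within (~` E) +oo%R,
      `|\sum_(i < m.+1) \sum_(1 <= j < n.+1)
             Ncount j r (trop_div (@trop_one R) (ff i))
         - \sum_(1 <= j < n.+1)
             Ncount j r (trop_div (@trop_one R) (casoratian ff))|
      <= \sum_(1 <= j < n.+1)
           `|Ncount j r (casoratian ff)
              - \sum_(i < m.+1) Ncount j r (trop_shift i (ff i))|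
         + \sum_(i < m.+1) \sum_(1 <= j < (n./2).+1)
           `|Ncount_on (2 * j)%N (- (2 * i)%N%:R) 0 r
                (trop_div (@trop_one R) (trop_shift i (ff i)))
              - Ncount_on (2 * j)%N (- i%:R) i%:R r
                  (trop_div (@trop_one R) (ff i))|
         + err r.
Proof.
have [[[d [dE dn]] _] _] := hf.
have fe i : entire n (ff i).
  by apply: trop_entire_entire (dE i); rewrite -dn; exact: leq_bigmax.
(* The explicit remainder of [counting_difference_le] is the error term; that inequality holds for
   all r > 0, and the exceptional set enters only through the smallness of [error]. *)
pose error r := root_total n ff (r + m%:R) - root_total n ff (r - m%:R) +
  (`|casoratian_defect ff r| + `|casoratian_defect ff (- r)|
   + 2 * `|casoratian_defect ff 0|).
have error_ge0 r : 0 <= error r.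
  apply: addr_ge0; last by apply: addr_ge0; [exact: addr_ge0|exact: mulr_ge0].
  rewrite subr_ge0 root_total_le// lerD2l.
  by rewrite (@le_trans _ _ 0) ?oppr_le0.
suff [E mE err_small] : exists2 E, finite_log_measure E & forall e, 0 < e ->
    \forall r \near +oo, ~ E r ->
      error r <= e * `|Tchar ff r / r `^ sigma|.
  exists E => //; exists error => [e e0|].
    rewrite near_withinE; apply: filterS (err_small e e0) => r H /H.
    by rewrite (ger0_norm (error_ge0 r)).
  rewrite near_withinE; near=> r => _; apply: (counting_difference_le fe).
  by near: r; exact: nbhs_pinfty_gt.
(* If T has no linear lower bound, [error] is identically 0 and the empty exceptional set
   suffices. *)
have [[c c0 Tc]|[S0 D0]] := Tchar_dichotomy fe; last first.
  exists set0 => [|e e0]; first exact: finite_log_measure0.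
  apply: nearW => r _; rewrite /error !S0 !D0 normr0 subrr mulr0 !addr0.
  by rewrite mulr_ge0// ltW.
have T1 : \forall r \near +oo, expR 1 <= Tchar ff r by exact: Tchar_large Tc _.
have sigma1 : sigma < 1.
  have := hyper_order_ge0 T1; case: (hyper_order (Tchar ff)) hsigma1 => [h| |]//.
  by rewrite -EFinB lte_fin lee_fin => *; lra.
have [rho hrho' rhos] := lte_sub_between hsigma1.
have [E mE HE] := root_total_small fe c0 Tc hsigma0 hrho' rhos.
exists E => // e e0.
have := error_small fe sigma1 c0 Tc HE e0; apply: filterS2 T1 => r Te H /H.
have T0 : 0 <= Tchar ff r / r `^ sigma.
  by rewrite divr_ge0 ?powR_ge0// (le_trans _ Te)// expR_ge0.
by rewrite powRN (ger0_norm T0).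
Unshelve. all: by end_near. Qed.
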